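(* Let $G$ be a compact group with Haar measure $\mu$ normalized so that $\mu(G)=1$, and let $\operatorname P$ and $\operatorname R$ be bounded linear operators on $L^2(G)$. Suppose that $\operatorname P$ commutes with the projection $g\mapsto \chi_S g$ for every measurable subset $S\subseteq G$, and that $\operatorname R$ commutes with left multiplication by elements of $G$, i.e. $\operatorname R\operatorname L_x=\operatorname L_x\operatorname R$ for all $x\in G$, where $[\operatorname L_x f](y)=f(x^{-1}y)$. Then $$\|\operatorname{PR}\|_2=\|\operatorname P\cdot \chi_G\|_2\,\|\operatorname R\|_2,$$ and consequently $\|\operatorname{PR}\|\le \|\operatorname P\cdot\chi_G\|_2\,\|\operatorname R\|_2$.
   Context: $\chi_S$ denotes the characteristic function of $S$, so $\chi_G$ is the constant function $1$. For a function, $\|\cdot\|_2$ is the $L^2(G,\mu)$-norm; for an operator, $\|\cdot\|_2$ denotes the Hilbert–Schmidt norm (possibly infinite), and $\|\cdot\|$ denotes the operator norm. *)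

(* Defs.v *)
(* Complex numbers are R[i] (mathcomp-real-closed). *)
From mathcomp Require Import all_boot all_algebra.
From mathcomp Require Import all_classical all_reals all_analysis.
From mathcomp Require Export complex.
Export GRing.Theory Num.Theory.
Set Implicit Arguments. Unset Strict Implicit. Unset Printing Implicit Defensive.
Local Open Scope classical_set_scope.
Local Open Scope ring_scope.
Local Open Scope complex_scope.

(* A compact (Hausdorff) topological group structure on the topological space G. *)
Record compact_group (G : ptopologicalType) := CompactGroup {
  cg_mul : G -> G -> G;
  cg_inv : G -> G;
  cg_one : G;
  cg_mulA : forall x y z, cg_mul x (cg_mul y z) = cg_mul (cg_mul x y) z;
  cg_mul1g : forall x, cg_mul cg_one x = x;
  cg_mulVg : forall x, cg_mul (cg_inv x) x = cg_one;
  cg_mul_cont : continuous (fun p : G * G => cg_mul p.1 p.2);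
  cg_inv_cont : continuous cg_inv;
  cg_hausdorff : hausdorff_space G;
  cg_compact : compact [set: G] }.

(* G with its Borel sigma-algebra (generated by the open sets). *)
Definition borel_of (G : ptopologicalType) := g_sigma_algebraType (@open G).

Section Defs.
Context (R : realType) (G : ptopologicalType).
Local Notation B := (borel_of G).
Local Notation C := R[i].

(* mu is a Haar measure: left invariant and (Radon) regular; normalization mu G = 1
   is built into the type (probability). *)
Definition is_haar (grp : compact_group G) (mu : probability B R) : Prop :=
  [/\ (forall (x : G) (A : set B), measurable A ->
         mu [set cg_mul grp x a | a in A] = mu A),
      (forall A : set B, measurable A ->
         mu A = ereal_inf [set mu U | U in [set U : set B | open (U : set G) /\ A `<=` U]])
    & (forall U : set B, open (U : set G) ->
         mu U = ereal_sup [set mu K | K in [set K : set B | compact (K : set G) /\ K `<=` U]])].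

Definition sqabs (z : C) : R := complex.Re z ^+ 2 + complex.Im z ^+ 2.

(* square-integrable complex functions *)
Definition L2 (mu : probability B R) (f : B -> C) : Prop :=
  [/\ measurable_fun setT (fun x => complex.Re (f x)),
      measurable_fun setT (fun x => complex.Im (f x))
    & (\int[mu]_x (sqabs (f x))%:E < +oo)%E].

Definition l2norm (mu : probability B R) (f : B -> C) : R :=
  Num.sqrt (fine (\int[mu]_x (sqabs (f x))%:E)).

Definition inner (mu : probability B R) (f g : B -> C) : C :=
  (Rintegral mu setT (fun x => complex.Re (f x * (g x)^*)))%:C
  + 'i * (Rintegral mu setT (fun x => complex.Im (f x * (g x)^*)))%:C.

(* equality in L^2(G), i.e. mu-almost everywhere *)
Definition aeq (mu : probability B R) (f g : B -> C) : Prop := ae_eq mu setT f g.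

(* A bounded linear operator on L^2(G), represented on representatives. *)
Definition bounded_op (mu : probability B R) (T : (B -> C) -> (B -> C)) : Prop :=
  [/\ (forall f, L2 mu f -> L2 mu (T f)),
      (forall f g, L2 mu f -> L2 mu g -> aeq mu f g -> aeq mu (T f) (T g)),
      (forall (a : C) f g, L2 mu f -> L2 mu g ->
         aeq mu (T (fun x => a * f x + g x)) (fun x => a * T f x + T g x))
    & exists M : R, forall f, L2 mu f -> l2norm mu (T f) <= M * l2norm mu f].

(* orthonormal basis of L^2(G) *)
Definition ONB (mu : probability B R) (E : set (B -> C)) : Prop :=
  [/\ (forall e, E e -> L2 mu e),
      (forall e e', E e -> E e' -> inner mu e e' = if `[< e = e' >] then 1 else 0)
    & (forall f, L2 mu f -> (forall e, E e -> inner mu f e = 0) -> aeq mu f (fun=> 0))].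

Definition some_ONB (mu : probability B R) : set (B -> C) := xget set0 (ONB mu).

Definition esqrt (x : \bar R) : \bar R :=
  match x with
  | r%:E => (Num.sqrt r)%:E
  | +oo%E => +oo%E
  | -oo%E => 0%E
  end.

(* Hilbert-Schmidt norm (possibly +oo), computed in an orthonormal basis *)
Definition HSnorm (mu : probability B R) (T : (B -> C) -> (B -> C)) : \bar R :=
  esqrt (\esum_(e in some_ONB mu) ((l2norm mu (T e)) ^+ 2)%:E).

(* operator norm *)
Definition opnorm (mu : probability B R) (T : (B -> C) -> (B -> C)) : \bar R :=
  ereal_sup [set (l2norm mu (T f))%:E | f in [set f | L2 mu f /\ l2norm mu f <= 1]].

(* characteristic function of S *)
Definition chi (S : set B) (x : B) : C := if `[< S x >] then 1 else 0.

(* left translation [L_x f](y) = f(x^{-1} y) *)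
Definition Ltr (grp : compact_group G) (x : G) (f : B -> C) : B -> C :=
  fun y => f (cg_mul grp (cg_inv grp x) y).

End Defs.
Arguments chi {R G} S x.

(* Main.v *)
(* P is multiplication by p = P 1.  For an orthonormal basis E put
     nu(S) = sum_(e in E) || chi_S R e ||^2 = sum_(e in E) \int_S |R e|^2.
   A translate of E is again orthonormal, and Hilbert-Schmidt sums do not depend on the
   orthonormal basis, so nu is left invariant; uniqueness of the Haar measure then suggests
   nu(S) = mu(S) || R ||_2^2 (with 0 * oo = 0), and integrating |p|^2 against nu gives the
   claim.  As G need not be second countable and nu need not be sigma-finite, uniqueness is
   replaced by an averaging argument: for every finite measure h mu and S there is x with
   \int_(xS) h >= mu(S) \int h - eps.  Applied to the finite partial sums of |R e|^2 this
   gives nu(S) >= mu(S) nu(G), and the same inequality for the complement of S gives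
   equality. *)

Require Import Defs.
From mathcomp Require Import all_boot all_order all_algebra.
From mathcomp Require Import all_classical all_reals all_analysis.
From mathcomp Require Import measurable_realfun complex finmap ring lra.
Import Order.TTheory GRing.Theory Num.Theory numFieldNormedType.Exports.
Set Implicit Arguments. Unset Strict Implicit. Unset Printing Implicit Defensive.
Local Open Scope classical_set_scope.
Local Open Scope ring_scope.

(** * The space L^2 *)

Section Sqabs.
Context {R : realType}.
Implicit Types z w : R[i].

(** The Hilbert-Schmidt sum is tied to one chosen basis, and its independence of the basis is only
    ever used as an inequality: a finite orthonormal family has a sum at most that of the basis.
    Translated basis vectors need no more, and for a single unit vector it bounds the operator norm.
    It is proved without adjoints: finitely many vectors are projected onto the span of a finite
    part of E, where the bound is Bessel's inequality, applied pointwise in x. The projections must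
    come close to the vectors, while [ONB] only asks for a trivial orthogonal complement; this is
    where the completeness of L^2 enters. Averaging over x produces mu(S^-1) rather than mu(S); for
    open sets the two agree by the same averaging with h = 1. The basis may be uncountable, so no
    limit is interchanged directly with the sum over E: limits are taken under finite partial
    sums. *)

Lemma sqabs_ge0 z : 0 <= sqabs z.
Proof. by rewrite addr_ge0 ?sqr_ge0. Qed.

Lemma sqabs0 : sqabs (0 : R[i]) = 0.
Proof. by rewrite /sqabs /= expr0n addr0. Qed.

Lemma sqabs1 : sqabs (1 : R[i]) = 1.
Proof. by rewrite /sqabs /= expr0n expr1n addr0. Qed.

Lemma sqabs_eq0 z : sqabs z = 0 -> z = 0.
Proof.
case: z => a b /eqP; rewrite /sqabs /= paddr_eq0 ?sqr_ge0// !sqrf_eq0.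
by case/andP => /eqP -> /eqP ->.
Qed.

Lemma sqabsM z w : sqabs (z * w) = sqabs z * sqabs w.
Proof. by case: z => a b; case: w => c d; rewrite /sqabs /=; ring. Qed.

Lemma sqabsN z : sqabs (- z) = sqabs z.
Proof. by case: z => a b; rewrite /sqabs /=; ring. Qed.

Lemma sqabsJ z : sqabs (z^*)%C = sqabs z.
Proof. by case: z => a b; rewrite /sqabs /=; ring. Qed.

Lemma sqabsR (r : R) : sqabs (r%:C)%C = r ^+ 2.
Proof. by rewrite /sqabs /= expr0n addr0. Qed.

Lemma mulcJ z : z * (z^*)%C = ((sqabs z)%:C)%C.
Proof. by case: z => a b; apply/eqP; rewrite /sqabs eq_complex /=; apply/andP; split; apply/eqP; ring. Qed.

Lemma sqabsD_le z w : sqabs (z + w) <= 2 * (sqabs z + sqabs w).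
Proof.
case: z => a b; case: w => c d; rewrite /sqabs /=.
have := sqr_ge0 (a - c); have := sqr_ge0 (b - d); nra.
Qed.

Lemma sqabsB_le z w : sqabs (z - w) <= 2 * (sqabs z + sqabs w).
Proof. by rewrite (le_trans (sqabsD_le _ _))// sqabsN. Qed.

End Sqabs.

Section L2basics.
Context {R : realType} {G : ptopologicalType} (mu : probability (borel_of G) R).
Local Notation B := (borel_of G).
Local Notation C := R[i].
Implicit Types (f g : B -> C) (S : set B).

Definition cmeasurable f :=
  measurable_fun setT (fun x => complex.Re (f x)) /\
  measurable_fun setT (fun x => complex.Im (f x)).

Lemma cmeasurable_cst (c : C) : cmeasurable (fun=> c).
Proof. by split; exact: measurable_cst. Qed.

Lemma cmeasurableD f g : cmeasurable f -> cmeasurable g ->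
  cmeasurable (fun x => f x + g x).
Proof.
move=> [f1 f2] [g1 g2]; split.
- rewrite (_ : (fun x => _) = (fun x => complex.Re (f x) + complex.Re (g x))).
    exact: measurable_funD.
  by apply/funext => x; case: (f x); case: (g x).
- rewrite (_ : (fun x => _) = (fun x => complex.Im (f x) + complex.Im (g x))).
    exact: measurable_funD.
  by apply/funext => x; case: (f x); case: (g x).
Qed.

Lemma cmeasurableM f g : cmeasurable f -> cmeasurable g ->
  cmeasurable (fun x => f x * g x).
Proof.
move=> [f1 f2] [g1 g2]; split.
- rewrite (_ : (fun x => _) = (fun x => complex.Re (f x) * complex.Re (g x)
                                        - complex.Im (f x) * complex.Im (g x))).
    by apply: measurable_funB; exact: measurable_funM.
  by apply/funext => x; case: (f x); case: (g x).
- rewrite (_ : (fun x => _) = (fun x => complex.Re (f x) * complex.Im (g x)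
                                        + complex.Im (f x) * complex.Re (g x))).
    by apply: measurable_funD; exact: measurable_funM.
  by apply/funext => x; case: (f x); case: (g x) => /= *.
Qed.

Lemma cmeasurableN f : cmeasurable f -> cmeasurable (fun x => - f x).
Proof.
move=> mf; rewrite (_ : (fun x => - f x) = (fun x => -1 * f x)).
  by apply: cmeasurableM => //; exact: cmeasurable_cst.
by apply/funext => x; rewrite mulN1r.
Qed.

Lemma cmeasurableB f g : cmeasurable f -> cmeasurable g ->
  cmeasurable (fun x => f x - g x).
Proof. by move=> mf mg; apply: cmeasurableD => //; exact: cmeasurableN. Qed.

Lemma cmeasurableJ f : cmeasurable f -> cmeasurable (fun x => (f x)^*)%C.
Proof.
move=> [f1 f2]; split.
- by rewrite (_ : (fun x => _) = (fun x => complex.Re (f x)))//;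
    apply/funext => x; case: (f x).
- rewrite (_ : (fun x => _) = (fun x => - complex.Im (f x))).
    exact: measurable_funN.
  by apply/funext => x; case: (f x).
Qed.

Lemma chiE S x : chi S x = ((\1_S x : R)%:C)%C.
Proof.
rewrite /chi indicE; case: asboolP => Sx; first by rewrite mem_set.
by rewrite memNset.
Qed.

Lemma cmeasurable_chi S : measurable S -> cmeasurable (chi S).
Proof.
move=> mS; split.
- rewrite (_ : (fun x => _) = \1_S); first exact: measurable_indic.
  by apply/funext => x; rewrite chiE.
- rewrite (_ : (fun x => _) = cst 0); first exact: measurable_cst.
  by apply/funext => x; rewrite chiE.
Qed.

Lemma measurable_sqabs f : cmeasurable f ->
  measurable_fun setT (fun x => sqabs (f x)).
Proof. by move=> [f1 f2]; apply: measurable_funD; apply: measurable_funX. Qed.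

Lemma emeasurable_sqabs f : cmeasurable f ->
  measurable_fun setT (fun x => (sqabs (f x))%:E).
Proof. by move=> mf; apply/measurable_EFinP; exact: measurable_sqabs. Qed.

(** Kept in the extended reals: [l2norm] passes through [fine], which sends an infinite integral to
    0, so estimates on it would first need finiteness. *)
Definition nrm2 f : \bar R := (\int[mu]_x (sqabs (f x))%:E)%E.

Lemma nrm2_ge0 f : (0 <= nrm2 f)%E.
Proof. by apply: integral_ge0 => x _; rewrite lee_fin sqabs_ge0. Qed.

Lemma L2P f : L2 mu f <-> cmeasurable f /\ (nrm2 f < +oo)%E.
Proof. by split => [[]|[[]]]. Qed.

Lemma L2_cmeas f : L2 mu f -> cmeasurable f.
Proof. by case. Qed.
Hint Resolve L2_cmeas : core.

Lemma L2_fin_num f : L2 mu f -> nrm2 f \is a fin_num.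
Proof. by move=> /L2P [_ ?]; rewrite ge0_fin_numE ?nrm2_ge0. Qed.

Lemma l2norm_ge0 f : 0 <= l2norm mu f.
Proof. exact: sqrtr_ge0. Qed.

Lemma l2norm_sqr f : l2norm mu f ^+ 2 = fine (nrm2 f).
Proof. by rewrite sqr_sqrtr// fine_ge0// nrm2_ge0. Qed.

Lemma nrm2E f : L2 mu f -> nrm2 f = (l2norm mu f ^+ 2)%:E.
Proof. by move=> /L2_fin_num Lf; rewrite l2norm_sqr fineK. Qed.

Lemma nrm2_le f g : cmeasurable g -> (forall x, sqabs (f x) <= sqabs (g x)) ->
  cmeasurable f -> (nrm2 f <= nrm2 g)%E.
Proof.
move=> mg fg mf; apply: ge0_le_integral => //.
- by move=> x _; rewrite lee_fin sqabs_ge0.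
- exact: emeasurable_sqabs.
- exact: emeasurable_sqabs.
- by move=> x _; rewrite lee_fin.
Qed.

Lemma nrm2Z (a : C) f : cmeasurable f -> nrm2 (fun x => a * f x) = ((sqabs a)%:E * nrm2 f)%E.
Proof.
move=> mf; rewrite /nrm2 -ge0_integralZl_EFin ?sqabs_ge0//; last 2 first.
- by move=> x _; rewrite lee_fin sqabs_ge0.
- exact: emeasurable_sqabs.
by apply: eq_integral => x _; rewrite sqabsM EFinM.
Qed.

Lemma nrm2D_le f g : cmeasurable f -> cmeasurable g ->
  (nrm2 (fun x => f x + g x)%R <= 2%:E * (nrm2 f + nrm2 g))%E.
Proof.
move=> mf mg; rewrite /nrm2 -ge0_integralD//; last 4 first.
- by move=> x _; rewrite lee_fin sqabs_ge0.
- exact: emeasurable_sqabs.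
- by move=> x _; rewrite lee_fin sqabs_ge0.
- exact: emeasurable_sqabs.
rewrite -ge0_integralZl_EFin//; last 2 first.
- by move=> x _; rewrite -EFinD lee_fin addr_ge0 ?sqabs_ge0.
- by apply: emeasurable_funD; exact: emeasurable_sqabs.
apply: ge0_le_integral => //.
- by move=> x _; rewrite lee_fin sqabs_ge0.
- by apply: emeasurable_sqabs; exact: cmeasurableD.
- rewrite (_ : (fun x => _) = (fun x => (2 * (sqabs (f x) + sqabs (g x)))%:E))//.
  apply/measurable_EFinP; apply: measurable_funM; first exact: measurable_cst.
  by apply: measurable_funD; exact: measurable_sqabs.
- by move=> x _; rewrite -EFinD -EFinM lee_fin sqabsD_le.
Qed.

Lemma L2D f g : L2 mu f -> L2 mu g -> L2 mu (fun x => f x + g x).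
Proof.
move=> /L2P[mf ff] /L2P[mg fg]; apply/L2P; split; first exact: cmeasurableD.
by rewrite (le_lt_trans (nrm2D_le mf mg))// lte_mul_pinfty// lte_add_pinfty.
Qed.

Lemma L2Z (a : C) f : L2 mu f -> L2 mu (fun x => a * f x).
Proof.
move=> /L2P[mf ff]; apply/L2P; split.
  by apply: cmeasurableM => //; exact: cmeasurable_cst.
by rewrite nrm2Z// lte_mul_pinfty// lee_fin sqabs_ge0.
Qed.

Lemma L2_lin (a : C) f g : L2 mu f -> L2 mu g -> L2 mu (fun x => a * f x + g x).
Proof. by move=> Lf Lg; apply: L2D => //; exact: L2Z. Qed.

Lemma L2N f : L2 mu f -> L2 mu (fun x => - f x).
Proof.
move=> Lf; rewrite (_ : (fun x => _) = (fun x => -1 * f x)); first exact: L2Z.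
by apply/funext => x; rewrite mulN1r.
Qed.

Lemma L2B f g : L2 mu f -> L2 mu g -> L2 mu (fun x => f x - g x).
Proof. by move=> Lf Lg; apply: L2D => //; exact: L2N. Qed.

Lemma L2_le f g : cmeasurable f -> (forall x, sqabs (f x) <= sqabs (g x)) ->
  L2 mu g -> L2 mu f.
Proof.
move=> mf fg /L2P[mg fing]; apply/L2P; split => //.
by rewrite (le_lt_trans _ fing)// nrm2_le.
Qed.

Lemma L2_cst (c : C) : L2 mu (fun=> c).
Proof.
apply/L2P; split; first exact: cmeasurable_cst.
by rewrite /nrm2 integral_cst// [X in (_ * X)%E](@probability_setT _ _ _ mu) mule1 ltry.
Qed.

Lemma sqabs_chi S x : sqabs (chi S x : C) = \1_S x.
Proof. by rewrite chiE sqabsR indicE; case: (_ \in _); rewrite ?expr1n ?expr0n. Qed.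

Lemma L2_chiM S f : measurable S -> L2 mu f -> L2 mu (fun x => chi S x * f x).
Proof.
move=> mS Lf; apply: (L2_le _ _ Lf).
  by apply: cmeasurableM; [exact: cmeasurable_chi|exact: L2_cmeas].
move=> x; rewrite sqabsM sqabs_chi ler_piMl ?sqabs_ge0// indicE.
Qed.

Lemma nrm2_chiM S f : measurable S ->
  nrm2 (fun x => chi S x * f x) = (\int[mu]_(x in S) (sqabs (f x))%:E)%E.
Proof.
move=> mS; rewrite [RHS]integral_mkcond; apply: eq_integral => x _.
rewrite sqabsM sqabs_chi patchE indicE; case: ifP => _ /=.
  by rewrite mul1r.
by rewrite mul0r.
Qed.

Lemma aeq_trans f g h : aeq mu f g -> aeq mu g h -> aeq mu f h.
Proof. exact: ae_eq_trans. Qed.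

Lemma aeqP f g : aeq mu f g <-> {ae mu, forall x, f x = g x}.
Proof.
by split; apply: filterS => x; [apply|].
Qed.

Lemma nrm2_ae f g : cmeasurable f -> cmeasurable g -> aeq mu f g ->
  nrm2 f = nrm2 g.
Proof.
move=> mf mg fg; apply: ge0_ae_eq_integral => //.
- exact: emeasurable_sqabs.
- exact: emeasurable_sqabs.
- by move=> x _; rewrite lee_fin sqabs_ge0.
- by move=> x _; rewrite lee_fin sqabs_ge0.
- by move: fg; apply: filterS => x /[apply] ->.
Qed.

Lemma nrm2_eq0 f : cmeasurable f -> (nrm2 f = 0)%E <-> aeq mu f (fun=> 0).
Proof.
move=> mf; have := ae_eq_integral_abs mu measurableT (emeasurable_sqabs mf).
rewrite (_ : (\int[mu]_x `|_|)%E = nrm2 f); last first.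
  by apply: eq_integral => x _; rewrite gee0_abs// lee_fin sqabs_ge0.
move=> ->; split; apply: filterS => x /(_ I).
  by move=> [] /sqabs_eq0.
by move=> -> _; rewrite sqabs0.
Qed.

Lemma nrm2B_eq0 f g : cmeasurable f -> cmeasurable g ->
  nrm2 (fun x => f x - g x) = 0%E -> aeq mu f g.
Proof.
move=> mf mg /nrm2_eq0 H; have /H := cmeasurableB mf mg.
by apply: filterS => x /[apply] /eqP; rewrite subr_eq0 => /eqP.
Qed.

Lemma nrm2_eps f : (forall e : R, 0 < e -> (nrm2 f <= e%:E)%E) -> nrm2 f = 0%E.
Proof.
move=> H; apply/eqP; rewrite eq_le nrm2_ge0 andbT.
by apply/lee_addgt0Pr => e e0; rewrite add0e H.
Qed.

End L2basics.
#[export] Hint Resolve L2_cmeas : core.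

(** * The inner product, finite orthonormal families and Bessel's inequality *)

Section Inner.
Context {R : realType} {G : ptopologicalType} (mu : probability (borel_of G) R).
Local Notation B := (borel_of G).
Local Notation C := R[i].
Implicit Types (f g h k : B -> C) (S : set B) (a : C).

Let integrable_sqabs f : L2 mu f ->
  mu.-integrable setT (EFin \o (fun x => sqabs (f x))).
Proof.
move=> /L2P[mf ff]; apply/integrableP; split; first exact: emeasurable_sqabs.
rewrite (le_lt_trans _ ff)// le_eqVlt; apply/orP; left; apply/eqP.
by apply: eq_integral => x _; rewrite /= ger0_norm ?sqabs_ge0.
Qed.

Definition cintegral h : C :=
  ((Rintegral mu setT (fun x => complex.Re (h x)))
    +i* (Rintegral mu setT (fun x => complex.Im (h x))))%C.

Definition cintegrable h :=
  mu.-integrable setT (EFin \o (fun x => complex.Re (h x))) /\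
  mu.-integrable setT (EFin \o (fun x => complex.Im (h x))).

Lemma innerE f g : inner mu f g = cintegral (fun x => f x * (g x)^*)%C.
Proof.
rewrite /inner /cintegral; apply/eqP; rewrite eq_complex /=; apply/andP; split; apply/eqP.
  by rewrite !(mul0r, mulr0, mul1r, subr0, addr0).
by rewrite !(mul0r, mulr0, mul1r, subr0, addr0, add0r).
Qed.

Lemma cintegral_lin a h k : cintegrable h -> cintegrable k ->
  cintegral (fun x => a * h x + k x) = a * cintegral h + cintegral k.
Proof.
move=> [h1 h2] [k1 k2]; case: a => a b.
have Z (r : R) u : mu.-integrable setT (EFin \o u) ->
    mu.-integrable setT (EFin \o (fun x => r * u x)).
  by move=> iu; have := integrableZl measurableT r iu.
apply/eqP; rewrite eq_complex /=; apply/andP; split; apply/eqP.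
- rewrite -!RintegralZl// -RintegralB//; [|exact: Z..].
  rewrite -RintegralD//; last first.
    by have := integrableB measurableT (Z a _ h1) (Z b _ h2).
  by apply: eq_Rintegral => x _; case: (h x) (k x) => ? ? [].
- rewrite -!RintegralZl// -RintegralD//; [|exact: Z..].
  rewrite -RintegralD//; last first.
    by have := integrableD measurableT (Z a _ h2) (Z b _ h1).
  by apply: eq_Rintegral => x _; case: (h x) (k x) => ? ? [].
Qed.

Lemma cintegralJ h : cintegrable h ->
  cintegral (fun x => (h x)^*)%C = ((cintegral h)^*)%C.
Proof.
move=> [h1 h2]; apply/eqP; rewrite eq_complex /=; apply/andP; split; apply/eqP.
- by apply: eq_Rintegral => x _; case: (h x).
- rewrite -mulN1r -RintegralZl//.
  by apply: eq_Rintegral => x _; case: (h x) => /= *; rewrite mulN1r.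
Qed.

Let integrable_le (u v : B -> R) : measurable_fun setT u ->
  mu.-integrable setT (EFin \o v) -> (forall x, `|u x| <= v x) ->
  mu.-integrable setT (EFin \o u).
Proof.
move=> mu_ iv uv; apply: le_integrable iv => //; first by apply/measurable_EFinP.
by move=> x _ /=; rewrite lee_fin (le_trans (uv x))// ler_norm.
Qed.

(** Both parts of the product are dominated by |f|^2 + |g|^2, because 2|ab| <= a^2 + b^2; the
    squares of sums and differences fed to [lra] are these inequalities. *)
Lemma cintegrable_inner f g : L2 mu f -> L2 mu g ->
  cintegrable (fun x => f x * (g x)^*)%C.
Proof.
move=> Lf Lg.
have iD : mu.-integrable setT (EFin \o (fun x => sqabs (f x) + sqabs (g x))).
  by have := integrableD measurableT (integrable_sqabs Lf) (integrable_sqabs Lg).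
have [m1 m2] : cmeasurable (fun x => f x * (g x)^*)%C.
  by apply: cmeasurableM; [|apply: cmeasurableJ]; apply: L2_cmeas; eassumption.
split.
- apply: (integrable_le m1 iD) => x; case: (f x) => p q; case: (g x) => r s.
  rewrite /sqabs /= ler_norml.
  have := sqr_ge0 (p - r); have := sqr_ge0 (p + r); have := sqr_ge0 (q - s); have := sqr_ge0 (q + s).
  by move=> *; apply/andP; split; lra.
- apply: (integrable_le m2 iD) => x; case: (f x) => p q; case: (g x) => r s.
  rewrite /sqabs /= ler_norml.
  have := sqr_ge0 (p - s); have := sqr_ge0 (p + s); have := sqr_ge0 (q - r); have := sqr_ge0 (q + r).
  by move=> *; apply/andP; split; lra.
Qed.

Lemma inner_linl a f g h : L2 mu f -> L2 mu g -> L2 mu h ->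
  inner mu (fun x => a * f x + g x) h = a * inner mu f h + inner mu g h.
Proof.
move=> Lf Lg Lh; rewrite !innerE -cintegral_lin; [|exact: cintegrable_inner..].
by congr cintegral; apply/funext => x; rewrite mulrDl mulrA.
Qed.

Lemma inner_conj f g : L2 mu f -> L2 mu g ->
  inner mu g f = ((inner mu f g)^*)%C.
Proof.
move=> Lf Lg; rewrite !innerE -cintegralJ; last exact: cintegrable_inner.
congr cintegral; apply/funext => x.
by case: (f x) => p q; case: (g x) => r s; apply/eqP; rewrite eq_complex /=; apply/andP; split; apply/eqP; ring.
Qed.

Lemma innerff f : L2 mu f -> inner mu f f = ((l2norm mu f ^+ 2)%:C)%C.
Proof.
move=> Lf; rewrite innerE l2norm_sqr; apply/eqP; rewrite eq_complex /=; apply/andP; split; apply/eqP.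
  congr fine; apply: eq_integral => x _.
  by case: (f x) => p q /=; rewrite /sqabs/=; congr EFin; ring.
rewrite /Rintegral integral0_eq// => x _.
by case: (f x) => p q /=; congr EFin; ring.
Qed.

Lemma inner0l f : inner mu (fun=> 0) f = 0.
Proof.
rewrite innerE; apply/eqP; rewrite eq_complex /=; apply/andP; split; apply/eqP;
  by rewrite /Rintegral integral0_eq// => x _; rewrite mul0r.
Qed.

Lemma innerBl f g h : L2 mu f -> L2 mu g -> L2 mu h ->
  inner mu (fun x => f x - g x) h = inner mu f h - inner mu g h.
Proof.
move=> Lf Lg Lh; have := inner_linl (-1) Lg Lf Lh; rewrite mulN1r addrC => <-.
by congr inner; apply/funext => x; rewrite mulN1r addrC.
Qed.

Lemma innerBr f g h : L2 mu f -> L2 mu g -> L2 mu h ->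
  inner mu h (fun x => f x - g x) = inner mu h f - inner mu h g.
Proof.
move=> Lf Lg Lh; rewrite (inner_conj (L2B Lf Lg) Lh).
by rewrite innerBl// rmorphB/= (inner_conj Lf Lh) (inner_conj Lg Lh).
Qed.

Lemma L2_sum I (r : seq I) (c : I -> C) (g : I -> B -> C) :
  (forall i, L2 mu (g i)) -> L2 mu (fun x => \sum_(i <- r) c i * g i x).
Proof.
move=> Lg; elim: r => [|i r IH].
  rewrite (_ : (fun x => _) = (fun=> 0)); first exact: L2_cst.
  by apply/funext => x; rewrite big_nil.
rewrite (_ : (fun x => _) = (fun x => c i * g i x + \sum_(j <- r) c j * g j x)).
  exact: L2_lin.
by apply/funext => x; rewrite big_cons.
Qed.

Lemma inner_suml I (r : seq I) (c : I -> C) (g : I -> B -> C) f :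
  (forall i, L2 mu (g i)) -> L2 mu f ->
  inner mu (fun x => \sum_(i <- r) c i * g i x) f = \sum_(i <- r) c i * inner mu (g i) f.
Proof.
move=> Lg Lf; elim: r => [|i r IH].
  rewrite big_nil (_ : (fun x => _) = (fun=> 0)); first exact: inner0l.
  by apply/funext => x; rewrite big_nil.
rewrite big_cons -IH -inner_linl//; last exact: L2_sum.
by congr inner; apply/funext => x; rewrite big_cons.
Qed.

Lemma bounded_op_sum T I (r : seq I) (c : I -> C) (g : I -> B -> C) :
  bounded_op mu T -> (forall i, L2 mu (g i)) ->
  aeq mu (T (fun x => \sum_(i <- r) c i * g i x)) (fun x => \sum_(i <- r) c i * T (g i) x).
Proof.
move=> [TL Tae Tlin _] Lg; elim: r => [|i r IH].
  have L0 := L2_cst mu (0 : C).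
  (* The empty sum needs T 0 = 0, read off from linearity with a = -1 and f = g = 0, which gives - T
     0 + T 0. *)
  rewrite (_ : (fun x => _) = (fun x => -1 * (fun=> 0 : C) x + (fun=> 0) x)); last first.
    by apply/funext => x; rewrite big_nil mulr0 addr0.
  apply: aeq_trans (Tlin _ _ _ L0 L0) _; apply/aeqP; apply: aeW => x.
  by rewrite big_nil mulN1r addNr.
rewrite (_ : (fun x => _) = (fun x => c i * g i x + \sum_(j <- r) c j * g j x)); last first.
  by apply/funext => x; rewrite big_cons.
have Ls : L2 mu (fun x => \sum_(j <- r) c j * g j x) by exact: L2_sum.
apply: aeq_trans (Tlin _ _ _ (Lg i) Ls) _.
by move: IH => /aeqP IH; apply/aeqP; apply: filterS IH => x ->; rewrite big_cons.
Qed.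

Lemma bounded_opN T f g : bounded_op mu T -> L2 mu f -> L2 mu g ->
  aeq mu (T (fun x => f x - g x)) (fun x => T f x - T g x).
Proof.
move=> [TL Tae Tlin _] Lf Lg.
rewrite (_ : (fun x => f x - g x) = (fun x => -1 * g x + f x)); last first.
  by apply/funext => x; rewrite mulN1r addrC.
apply: aeq_trans (Tlin _ _ _ Lg Lf) _; apply/aeqP; apply: aeW => x.
by rewrite mulN1r addrC.
Qed.

Lemma bounded_op_nrm2 T : bounded_op mu T ->
  exists2 M : R, 0 < M & forall f, L2 mu f -> (nrm2 mu (T f) <= M%:E * nrm2 mu f)%E.
Proof.
(* The extra 1 makes the constant strictly positive even for M = 0, so that it can be cancelled in
   later inequalities. *)
move=> [TL _ _ [M TM]]; exists (M ^+ 2 + 1); first by rewrite ltr_wpDl// sqr_ge0.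
move=> f Lf; rewrite (nrm2E (TL _ Lf)) (nrm2E Lf) -EFinM lee_fin.
have h := TM _ Lf; have h0 := l2norm_ge0 mu (T f).
rewrite (@le_trans _ _ ((M * l2norm mu f) ^+ 2))//.
  by rewrite ler_sqr ?nnegrE// (le_trans h0).
by rewrite exprMn ler_wpM2r ?sqr_ge0// lerDl.
Qed.

(** Indexed by a finite type, so that translated basis vectors or a single unit vector can be used
    without forming their image as a set. *)
Definition orthonormal_family (I : finType) (g : I -> B -> C) :=
  (forall i, L2 mu (g i)) /\ forall i j, inner mu (g i) (g j) = (i == j)%:R.

Section Orthonormal.
Variables (I : finType) (g : I -> B -> C).
Hypothesis og : orthonormal_family g.
Let Lg := og.1.

Lemma inner_comb (c : I -> C) j :
  inner mu (fun x => \sum_i c i * g i x) (g j) = c j.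
Proof.
rewrite inner_suml// (bigD1 j)//= og.2 eqxx mulr1 big1 ?addr0// => i /negbTE ij.
by rewrite og.2 ij mulr0.
Qed.

Lemma inner_comb_self (c : I -> C) f : L2 mu f ->
  inner mu (fun x => \sum_i c i * g i x) f = \sum_i c i * (inner mu f (g i))^*%C.
Proof.
by move=> Lf; rewrite inner_suml//; apply: eq_bigr => i _; rewrite -inner_conj.
Qed.

Lemma nrm2_comb (c : I -> C) :
  nrm2 mu (fun x => \sum_i c i * g i x) = (\sum_i sqabs (c i))%:E.
Proof.
have Ls : L2 mu (fun x => \sum_i c i * g i x) by exact: L2_sum.
have := innerff Ls; rewrite inner_comb_self//.
under eq_bigr do rewrite inner_comb mulcJ.
by rewrite -rmorph_sum/= => /complexI e; rewrite (nrm2E Ls) -e.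
Qed.

(** Pythagoras: the inner products of f with p and of p with p both equal the sum of the squared
    coefficients. Being an equality, it shows that enlarging the family can only shrink the
    residual. *)
Lemma nrm2_proj f : L2 mu f ->
  nrm2 mu (fun x => f x - \sum_i inner mu f (g i) * g i x)
  = (nrm2 mu f - (\sum_i sqabs (inner mu f (g i)))%:E)%E.
Proof.
move=> Lf; pose p x := \sum_i inner mu f (g i) * g i x; rewrite -/p; have Lp : L2 mu p by exact: L2_sum.
have Lfp := L2B Lf Lp.
rewrite (nrm2E Lf) (nrm2E Lfp) -EFinB; congr EFin; apply: complexI.
rewrite -innerff// innerBl// !innerBr// innerff// -innerff//.
rewrite (inner_conj Lp Lf) inner_comb_self// [inner mu p p]inner_comb_self//.
under [X in _ - _ - (_ - X)]eq_bigr do rewrite inner_comb.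
have -> : \sum_i inner mu f (g i) * (inner mu f (g i))^*%C =
    ((\sum_i sqabs (inner mu f (g i)))%:C)%C.
  by rewrite rmorph_sum; apply: eq_bigr => i _; rewrite mulcJ.
by rewrite subrr subr0 conjc_real innerff// -rmorphB.
Qed.

Lemma bessel f : L2 mu f -> ((\sum_i sqabs (inner mu f (g i)))%:E <= nrm2 mu f)%E.
Proof.
move=> Lf; rewrite -sube_ge0; first by rewrite -nrm2_proj// nrm2_ge0.
by rewrite (L2_fin_num Lf).
Qed.

End Orthonormal.
End Inner.

(** * Completeness of L^2 *)

(** The telescoping series converges absolutely: the partial sums of its norms are nondecreasing and
    bounded by M. *)
Lemma cvgn_bounded_variation (R : realType) (a : nat -> R) (M : R) :
  (forall n, \sum_(0 <= k < n) `|a k.+1 - a k| <= M) -> cvgn a.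
Proof.
move=> aM; rewrite (_ : a = (fun n => a 0%N + series (telescope a) n)); last first.
  by apply/funext => n; rewrite -eq_sum_telescope.
apply: is_cvgD; first exact: is_cvg_cst.
apply: normed_cvg; apply: nondecreasing_is_cvgn.
  apply/nondecreasing_seqP => n.
  change (\sum_(0 <= k < n) `|telescope a k| <= \sum_(0 <= k < n.+1) `|telescope a k|).
  rewrite big_nat_recr//= lerDl.
  exact: normr_ge0.
exists M => _ [n _ <-]; exact: aM.
Qed.

Lemma limn_einf_le (R : realType) (u : (\bar R)^nat) (c : \bar R) n :
  (forall m, (n <= m)%N -> (u m <= c)%E) -> (limn_einf u <= c)%E.
Proof.
move=> uc; rewrite limn_einf_lim; apply: lime_le; first exact: is_cvg_einfs.
apply: nearW => k; apply: (le_trans _ (uc (maxn k n) (leq_maxr _ _))).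
by apply: ereal_inf_lbound; exists (maxn k n) => //=; exact: leq_maxl.
Qed.

Section Completeness.
Context {R : realType} {G : ptopologicalType} (mu : probability (borel_of G) R).
Local Notation B := (borel_of G).
Local Notation C := R[i].

(** Young's inequality with a free parameter t: it turns control of the square into control of the
    modulus, in place of Cauchy-Schwarz. *)
Let sqabs_bound (z : C) (t : R) : 0 < t ->
  `|complex.Re z| <= t + t^-1 * sqabs z /\ `|complex.Im z| <= t + t^-1 * sqabs z.
Proof.
move=> t0; case: z => a b; rewrite /sqabs /=; split.
- rewrite -(ler_pM2l t0) mulrDr mulrA divff ?gt_eqF// mul1r.
  have := sqr_ge0 (`|a| - t); rewrite sqrrB real_normK ?num_real//.
  by have := sqr_ge0 b; have := normr_ge0 a; nra.
- rewrite -(ler_pM2l t0) mulrDr mulrA divff ?gt_eqF// mul1r.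
  have := sqr_ge0 (`|b| - t); rewrite sqrrB real_normK ?num_real//.
  by have := sqr_ge0 a; have := normr_ge0 b; nra.
Qed.

Section Rapidly_Cauchy.
Variable u : nat -> B -> C.
Hypothesis Lu : forall n, L2 mu (u n).
Hypothesis du : forall n m, (n <= m)%N ->
  (nrm2 mu (fun x => (u m x - u n x)%R) <= (4^-1 ^+ n)%:E)%E.

(** The bound of [sqabs_bound] at t = 2^-n for the n-th increment. As the increment has squared norm
    at most 4^-n, both summands have integral at most 2^-n. *)
Let h n x : R := 2^-1 ^+ n + 2 ^+ n * sqabs (u n.+1 x - u n x).

Let h_ge0 n x : 0 <= h n x.
Proof. by rewrite addr_ge0 ?exprn_ge0// mulr_ge0 ?exprn_ge0 ?sqabs_ge0. Qed.

Let mdu n m : cmeasurable (fun x => u m x - u n x).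
Proof. by apply: cmeasurableB; exact: L2_cmeas. Qed.

Let mh n : measurable_fun setT (EFin \o h n).
Proof.
apply/measurable_EFinP; apply: measurable_funD; first exact: measurable_cst.
apply: measurable_funM; first exact: measurable_cst.
exact: measurable_sqabs.
Qed.

Let H x := (\sum_(0 <= n <oo) (h n x)%:E)%E.

Let H_ge0 x : (0 <= H x)%E.
Proof. by apply: nneseries_ge0 => n _ _; rewrite lee_fin. Qed.

Let mH : measurable_fun setT H.
Proof.
by apply: ge0_emeasurable_sum => [k x _ _|k _]; [rewrite lee_fin|exact: mh].
Qed.

(** The right-hand side is 2 / 2^n, written in the shape that [epsilon_trick0] sums. *)
Let int_h n : (\int[mu]_x (h n x)%:E <= (4 / (2 ^ n.+1)%:R)%:E)%E.
Proof.
rewrite (_ : (\int[mu]_x (h n x)%:E)%E =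
    ((2^-1 ^+ n)%:E + (2 ^+ n)%:E * nrm2 mu (fun x => (u n.+1 x - u n x)%R))%E); last first.
  have -> : (2^-1 ^+ n)%:E = (\int[mu]_x (cst (2^-1 ^+ n : R)%:E) x)%E :> \bar R.
    by rewrite integral_cst// [X in (_ * X)%E](@probability_setT _ _ _ mu) mule1.
  rewrite /nrm2 -ge0_integralZl_EFin ?exprn_ge0//; last 2 first.
  - by move=> x _; rewrite lee_fin sqabs_ge0.
  - exact: emeasurable_sqabs.
  rewrite -ge0_integralD//.
  - by move=> x _; rewrite lee_fin exprn_ge0.
  - by move=> x _; rewrite -EFinM lee_fin mulr_ge0 ?exprn_ge0// sqabs_ge0.
  - apply/measurable_EFinP; apply: measurable_funM; first exact: measurable_cst.
    exact: measurable_sqabs.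
apply: (@le_trans _ _ ((2^-1 ^+ n)%:E + (2 ^+ n)%:E * (4^-1 ^+ n)%:E)%E).
  by rewrite leeD2l// lee_pmul2l ?lte_fin ?exprn_gt0// du.
rewrite -EFinM -EFinD lee_fin -exprMn natrX exprS invfM mulrA.
rewrite (_ : 2 * 4^-1 = 2^-1 :> R); last by field.
rewrite (_ : 4 / 2 = 2 :> R); last by field.
by rewrite exprVn; lra.
Qed.

(** A set of full measure on which the increments are summable. Multiplying the sequence by [chi A]
    makes it converge at every point, which gives a measurable limit. *)
Let A := [set x | (H x < +oo)%E].

Let mA : measurable A.
Proof.
rewrite (_ : A = setT `&` [set x | (H x < +oo)%E]); last by rewrite setTI.
exact: emeasurable_fun_infty_o.
Qed.

Let aeA : {ae mu, forall x, A x}.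
Proof.
have iH : mu.-integrable setT H.
  apply/integrableP; split; first exact: mH.
  under eq_integral do rewrite gee0_abs//.
  rewrite integral_nneseries//; last by move=> n x _; rewrite lee_fin.
  apply: le_lt_trans (ltry 4).
  apply: le_trans (epsilon_trick0 xpredT _) => //.
  apply: lee_nneseries => [n _ _|n _]; last exact: int_h.
  by apply: integral_ge0 => x _; rewrite lee_fin.
have := integrable_ae measurableT iH; apply: filterS => x /(_ I).
by rewrite ge0_fin_numE.
Qed.

(** Here [p] stands for the real or the imaginary part. The partial sums of the increments are
    bounded by [H x] on A; off A the sequence is constant. *)
Let cvg_part (p : C -> R) (pB : {morph p : x y / x - y}) :
  (forall z (t : R), 0 < t -> `|p z| <= t + t^-1 * sqabs z) ->
  forall x, cvgn (fun n => p (chi A x * u n x)).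
Proof.
move=> pb x; apply: (@cvgn_bounded_variation _ _ (fine (H x))) => n.
have [Ax|nAx] := pselect (A x); last first.
  rewrite big1 ?fine_ge0// => k _; rewrite -pB chiE indicE memNset//.
  by rewrite !mul0r -{2}(subrr 0) pB !subrr normr0.
rewrite -lee_fin fineK ?ge0_fin_numE//.
apply: (@le_trans _ _ (\sum_(0 <= k < n) (h k x)%:E)%E); last first.
  by apply: nneseries_lim_ge => k _ _; rewrite lee_fin.
rewrite sumEFin lee_fin; apply: ler_sum => k _.
rewrite -pB chiE indicE mem_set// !mul1r.
have t0 : 0 < 2^-1 ^+ k :> R by rewrite exprn_gt0.
by have := pb (u k.+1 x - u k x) _ t0; rewrite /h -exprVn invrK.
Qed.

Let cRe x : cvgn (fun n => complex.Re (chi A x * u n x)).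
Proof.
by apply: cvg_part => [[? ?] [? ?]//|z t t0]; have [] := sqabs_bound z t0.
Qed.

Let cIm x : cvgn (fun n => complex.Im (chi A x * u n x)).
Proof.
by apply: cvg_part => [[? ?] [? ?]//|z t t0]; have [] := sqabs_bound z t0.
Qed.

Let v x : C := (limn (fun n => complex.Re (chi A x * u n x))
  +i* limn (fun n => complex.Im (chi A x * u n x)))%C.

Let mw n : cmeasurable (fun x => chi A x * u n x).
Proof. by apply: cmeasurableM; [exact: cmeasurable_chi|exact: L2_cmeas]. Qed.

Let mv : cmeasurable v.
Proof.
split.
- apply: (@measurable_fun_cvg _ _ _ _ (fun n x => complex.Re (chi A x * u n x))).
    by move=> n; exact: (mw n).1.
  by move=> x _; exact: cRe.
- apply: (@measurable_fun_cvg _ _ _ _ (fun n x => complex.Im (chi A x * u n x))).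
    by move=> n; exact: (mw n).2.
  by move=> x _; exact: cIm.
Qed.

Let cvg_sqabs n x :
  (sqabs (chi A x * u m x - chi A x * u n x))%:E @[m --> \oo] -->
  (sqabs (v x - chi A x * u n x))%:E.
Proof.
apply: cvg_EFin; first by apply: nearW.
rewrite (_ : _ \o _ = fun m =>
    (complex.Re (chi A x * u m x) - complex.Re (chi A x * u n x)) ^+ 2
    + (complex.Im (chi A x * u m x) - complex.Im (chi A x * u n x)) ^+ 2); last first.
  by apply/funext => m /=; rewrite /sqabs; case: (_ * u m x) => ? ?; case: (_ * u n x).
rewrite (_ : sqabs _ = (complex.Re (v x) - complex.Re (chi A x * u n x)) ^+ 2
    + (complex.Im (v x) - complex.Im (chi A x * u n x)) ^+ 2); last first.
  by rewrite /sqabs; case: (v x) => ? ?; case: (_ * u n x).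
by apply: cvgD; rewrite expr2; under eq_fun do rewrite expr2; apply: cvgM;
  apply: cvgB; [exact: cRe|exact: cvg_cst|exact: cRe|exact: cvg_cst
    |exact: cIm|exact: cvg_cst|exact: cIm|exact: cvg_cst].
Qed.

(** Fatou's lemma as m grows with n fixed: the integrals of |u m - u n|^2 are at most 4^-n from m =
    n on. *)
Let nrm2_vu n : (nrm2 mu (fun x => (v x - u n x)%R) <= (4^-1 ^+ n)%:E)%E.
Proof.
have -> : nrm2 mu (fun x => v x - u n x) = nrm2 mu (fun x => v x - chi A x * u n x).
  apply: nrm2_ae.
  - by apply: cmeasurableB => //; exact: L2_cmeas.
  - exact: cmeasurableB.
  - apply/aeqP; move: aeA; apply: filterS => x Ax.
    by rewrite chiE indicE mem_set// mul1r.
have -> : nrm2 mu (fun x => v x - chi A x * u n x) = (\int[mu]_x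
    limn_einf (fun m => (sqabs (chi A x * u m x - chi A x * u n x))%:E))%E.
  apply: eq_integral => x _; have c := @cvg_sqabs n x.
  rewrite is_cvg_limn_einfE; first by rewrite (cvg_lim _ c).
  by apply/cvg_ex; eexists; exact: c.
apply: le_trans (fatou mu measurableT _ _) _.
- by move=> m; apply: emeasurable_sqabs; exact: cmeasurableB.
- by move=> m x _; rewrite lee_fin sqabs_ge0.
apply: (@limn_einf_le _ _ _ n) => m nm; apply: le_trans (du nm).
apply: nrm2_le; [exact: mdu| |exact: cmeasurableB].
move=> x; rewrite -mulrBr sqabsM sqabs_chi ler_piMl ?sqabs_ge0//.
Qed.

Lemma L2_complete :
  exists2 v, L2 mu v & forall n, (nrm2 mu (fun x => (v x - u n x)%R) <= (4^-1 ^+ n)%:E)%E.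
Proof.
exists v; last exact: nrm2_vu.
rewrite (_ : v = (fun x => (v x - u 0%N x) + u 0%N x)); last first.
  by apply/funext => x; rewrite subrK.
apply: (@L2D _ _ _ (fun x => v x - u 0%N x) (u 0%N)) => //; apply/L2P; split.
  by apply: cmeasurableB => //; exact: L2_cmeas.
exact: le_lt_trans (nrm2_vu 0) (ltry _).
Qed.

End Rapidly_Cauchy.
End Completeness.

(** * Orthonormal bases and Hilbert-Schmidt sums *)

Lemma exists_geometric_lt (R : realType) (e : R) : 0 < e -> exists n, 4^-1 ^+ n < e.
Proof.
move=> e0; exists (Num.bound e^-1); rewrite exprVn -[ltRHS]invrK.
rewrite ltf_pV2 ?posrE ?exprn_gt0 ?invr_gt0//.
apply: (@lt_le_trans _ _ (2 ^+ Num.bound e^-1)); first exact: upper_nthrootP.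
by rewrite lerXn2r ?nnegrE// ler_nat.
Qed.

Lemma big_fsetDsub (K : choiceType) (V : zmodType) (A A' : {fset K}) (q : K -> V) :
  (A `<=` A')%fset ->
  \sum_(e <- A') q e = \sum_(e <- A) q e + \sum_(e <- (A' `\` A)%fset) q e.
Proof.
move=> AA'; rewrite (big_fsetID _ (mem A)); congr (_ + _); congr (\sum_(e <- enum_fset _) _).
  apply/fsetP => x; rewrite !inE /=; case: (boolP (x \in A)); rewrite ?andbF ?andbT// => xA.
  by rewrite (fsubsetP AA').
by apply/fsetP => x; rewrite !inE /= andbC.
Qed.

(** * Finite combinations of basis vectors are dense *)

Section Density.
Context {R : realType} {G : ptopologicalType} (mu : probability (borel_of G) R).
Local Notation B := (borel_of G).
Local Notation C := R[i].
Variable E : set (B -> C).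
Hypothesis ONB_E : ONB mu E.

Let LE e : E e -> L2 mu e.
Proof. by case: ONB_E => + _ _; apply. Qed.

Let innerEE e e' : E e -> E e' -> inner mu e e' = if `[< e = e' >] then 1 else 0.
Proof. by case: ONB_E => _ + _; apply. Qed.

Lemma orthonormal_fset (A : {fset (B -> C)}) :
  [set` A] `<=` E -> orthonormal_family mu (fun e : A => val e).
Proof.
move=> AE; have AE' (e : A) : E (val e) by exact/AE/(fsvalP e).
split => [e|e e']; first exact: LE.
rewrite innerEE// -(inj_eq val_inj); case: asboolP => [->|/eqP/negbTE ->//].
by rewrite eqxx.
Qed.

Lemma nrm2_fset (A : {fset (B -> C)}) (c : (B -> C) -> C) : [set` A] `<=` E ->
  nrm2 mu (fun x => \sum_(e <- A) c e * e x) = (\sum_(e <- A) sqabs (c e))%:E.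
Proof.
move=> /orthonormal_fset oA; rewrite big_seq_fsetE/= -(nrm2_comb oA).
by congr nrm2; apply/funext => x; rewrite big_seq_fsetE.
Qed.

Lemma L2_fset (A : {fset (B -> C)}) (c : (B -> C) -> C) : [set` A] `<=` E ->
  L2 mu (fun x => \sum_(e <- A) c e * e x).
Proof.
move=> /orthonormal_fset oA.
rewrite (_ : (fun x => _) = (fun x => \sum_(e : A) c (val e) * val e x)).
  by apply: L2_sum => e; exact: oA.1.
by apply/funext => x; rewrite big_seq_fsetE.
Qed.

Lemma bessel_fset (A : {fset (B -> C)}) f : [set` A] `<=` E -> L2 mu f ->
  ((\sum_(e <- A) sqabs (inner mu f e))%:E <= nrm2 mu f)%E.
Proof.
by move=> /orthonormal_fset oA Lf; rewrite big_seq_fsetE/=; exact: (bessel oA).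
Qed.

Lemma sqabs_inner_le e f : E e -> L2 mu f -> ((sqabs (inner mu f e))%:E <= nrm2 mu f)%E.
Proof.
move=> Ee Lf; have := @bessel_fset [fset e]%fset f; rewrite big_seq_fset1; apply => //.
by move=> x /=; rewrite inE => /eqP ->.
Qed.

Lemma inner_fset (A : {fset (B -> C)}) (c : (B -> C) -> C) e : [set` A] `<=` E -> E e ->
  inner mu (fun x => \sum_(e <- A) c e * e x) e = if e \in A then c e else 0.
Proof.
move=> AE Ee; have oA := orthonormal_fset AE.
rewrite (_ : (fun x => _) = (fun x => \sum_(e : A) c (val e) * val e x)); last first.
  by apply/funext => x; rewrite big_seq_fsetE.
case: ifPn => eA; first exact: (inner_comb oA (fun e : A => c (val e)) [` eA]%fset).
rewrite inner_suml; [|exact: oA.1|exact: LE].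
rewrite big1// => i _; rewrite innerEE//; last exact/AE/(fsvalP i).
case: asboolP => [ie|]; last by rewrite mulr0.
by move: eA; rewrite -ie fsvalP.
Qed.

Lemma nrm2_proj_fset (A : {fset (B -> C)}) f : [set` A] `<=` E -> L2 mu f ->
  nrm2 mu (fun x => f x - \sum_(e <- A) inner mu f e * e x)
  = (nrm2 mu f - (\sum_(e <- A) sqabs (inner mu f e))%:E)%E.
Proof.
move=> /orthonormal_fset oA Lf; rewrite big_seq_fsetE/= -(nrm2_proj oA)//.
by congr nrm2; apply/funext => x; rewrite big_seq_fsetE.
Qed.

(** The projections of f along finite sets whose Bessel sums approach their supremum form a Cauchy
    sequence. Its limit v has the same coefficients as f, so f - v is orthogonal to E and vanishes
    almost everywhere. *)
Lemma ONB_dense f (eps : R) : L2 mu f -> 0 < eps ->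
  exists2 A : {fset (B -> C)}, [set` A] `<=` E &
    (nrm2 mu (fun x => (f x - \sum_(e <- A) inner mu f e * e x)%R) <= eps%:E)%E.
Proof.
move=> Lf eps0.
pose q e := sqabs (inner mu f e).
pose s (A : {fset (B -> C)}) := \sum_(e <- A) q e.
pose Q := [set s A | A in [set A : {fset (B -> C)} | [set` A] `<=` E]].
have sS (A A' : {fset (B -> C)}) : (A `<=` A')%fset -> s A <= s A'.
  move=> AA'; rewrite /s (big_fsetDsub _ AA') lerDl.
  by apply: sumr_ge0 => e _; exact: sqabs_ge0.
have supQ : has_sup Q.
  split; first by exists (s fset0), fset0 => //= x /=; rewrite inE.
  exists (l2norm mu f ^+ 2) => _ [A AE <-].
  by rewrite -lee_fin -nrm2E//; exact: bessel_fset.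
have sQ A : [set` A] `<=` E -> s A <= sup Q.
  by move=> AE; apply: (sup_upper_bound supQ); exists A.
have /choice[A PA] : forall n, exists A : {fset (B -> C)},
    [set` A] `<=` E /\ sup Q - 4^-1 ^+ n < s A.
  move=> n; have e0 : 0 < 4^-1 ^+ n :> R by rewrite exprn_gt0.
  by have [_ [A AE <-] As] := sup_adherent e0 supQ; exists A.
(* Running unions make the sets nested, so that [u m - u n] is a combination over the difference of
   two of them. *)
pose F := fix F n := if n is m.+1 then (F m `|` A m.+1)%fset else A 0%N.
have FE n : [set` F n] `<=` E.
  elim: n => [|n IH] x /=; first exact: (PA 0%N).1.
  by rewrite inE => /orP[/IH//|]; exact: (PA n.+1).1.
have FS n m : (n <= m)%N -> (F n `<=` F m)%fset.
  move=> /subnK <-; elim: (m - n)%N => [|k IH] //=.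
  by rewrite (fsubset_trans IH)// fsubsetUl.
have AF n : (A n `<=` F n)%fset by case: n => //= n; rewrite fsubsetUr.
have sF n : sup Q - s (F n) <= 4^-1 ^+ n.
  by have := sS _ _ (AF n); have := (PA n).2; lra.
pose u n x := \sum_(e <- F n) inner mu f e * e x.
have Lu n : L2 mu (u n) by exact: L2_fset.
have du n m : (n <= m)%N -> (nrm2 mu (fun x => (u m x - u n x)%R) <= (4^-1 ^+ n)%:E)%E.
  move=> nm; rewrite (_ : (fun x => _) =
      (fun x => \sum_(e <- (F m `\` F n)%fset) inner mu f e * e x)); last first.
    by apply/funext => x; rewrite /u (big_fsetDsub _ (FS _ _ nm)) addrC addKr.
  rewrite (nrm2_fset (fun e => inner mu f e)); last first.
    by move=> x /=; rewrite inE => /andP[_]; exact: FE.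
  (* The coefficients gained between [F n] and [F m] weigh at most the gap between [s (F n)] and the
     supremum. *)
  rewrite lee_fin (le_trans _ (sF n))// lerBrDl -[X in _ + X]/(\sum_(e <- (F m `\` F n)%fset) q e).
  by rewrite -(big_fsetDsub q (FS _ _ nm)); exact: sQ.
have [v Lv uv] := L2_complete Lu du.
have Lfv := L2B Lf Lv.
have fv : aeq mu (fun x => f x - v x) (fun=> 0).
  case: ONB_E => _ _; apply => // e Ee; apply: sqabs_eq0; apply/eqP.
  rewrite eq_le sqabs_ge0 andbT; apply/ler_addgt0Pr => d d0; rewrite add0r.
  (* Two terms of size 4^-n, each doubled by [sqabsB_le], must stay below d. *)
  have d4 : 0 < d / 4 by rewrite divr_gt0.
  have [n nd] := exists_geometric_lt d4.
  have -> : inner mu (fun x => f x - v x) e =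
      inner mu (fun x => f x - u n x) e - inner mu (fun x => v x - u n x) e.
    by have Le := LE Ee; rewrite !innerBl// opprB addrA subrK.
  rewrite (le_trans (sqabsB_le _ _))//.
  have h1 : sqabs (inner mu (fun x => v x - u n x) e) <= 4^-1 ^+ n.
    by rewrite -lee_fin (le_trans (sqabs_inner_le Ee (L2B Lv (Lu n)))).
  (* If e lies in [F n], its coefficient has been removed. Otherwise adding e to [F n] cannot push
     the Bessel sum beyond the supremum, so the coefficient is small. *)
  have h2 : sqabs (inner mu (fun x => f x - u n x) e) <= 4^-1 ^+ n.
    rewrite innerBl//; last exact: LE.
    rewrite (inner_fset (fun e => inner mu f e))//; case: ifPn => eF.
      by rewrite subrr sqabs0 exprn_ge0.
    rewrite subr0 (le_trans _ (sF n))// lerBrDr -[X in X + _]/(q e).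
    rewrite -(big_fsetU1 _ q eF); apply: sQ => x /=; rewrite !inE.
    by move=> /orP[/eqP ->//|]; exact: FE.
  by lra.
have [n neps] := exists_geometric_lt eps0.
exists (F n) => //.
have -> : nrm2 mu (fun x => f x - \sum_(e <- F n) inner mu f e * e x) =
    nrm2 mu (fun x => v x - u n x).
  apply: nrm2_ae; [exact: (L2_cmeas (L2B Lf (Lu n)))|exact: (L2_cmeas (L2B Lv (Lu n)))|].
  move: fv => /aeqP fv; apply/aeqP; apply: filterS fv => x /eqP.
  by rewrite subr_eq0 => /eqP ->.
by rewrite (le_trans (uv n))// lee_fin ltW.
Qed.

End Density.

(** * Existence of bases and comparison of Hilbert-Schmidt sums *)

Section HilbertSchmidt.
Context {R : realType} {G : ptopologicalType} (mu : probability (borel_of G) R).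
Local Notation B := (borel_of G).
Local Notation C := R[i].

(** Zorn's lemma: a vector of nonzero norm orthogonal to a maximal orthonormal set could be
    normalized and added. Existence guarantees that [some_ONB] is not merely the default value
    [set0], over which every Hilbert-Schmidt sum is 0. *)
Lemma exists_ONB : exists E, ONB mu E.
Proof.
pose P := [set E : set (B -> C) | (forall e, E e -> L2 mu e) /\
  (forall e e', E e -> E e' -> inner mu e e' = if `[< e = e' >] then 1 else 0)].
have [F FP Ftot|E [[EL Eo] Emax]] := @Zorn_bigcup _ P.
  split => [e [A FA Ae]|e e' [A FA Ae] [A' FA' Ae']]; first exact: (FP _ FA).1.
  have [AA'|A'A] := Ftot _ _ FA FA'.
    by apply: (FP _ FA').2 => //; exact: AA'.
  by apply: (FP _ FA).2 => //; exact: A'A.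
exists E; split => // f Lf fE.
have [f0|f0] := eqVneq (l2norm mu f) 0.
  by apply/(nrm2_eq0 mu (L2_cmeas Lf)); rewrite nrm2E// f0 expr0n.
exfalso.
pose g := fun x => (((l2norm mu f)^-1)%:C)%C * f x : C.
have Lg : L2 mu g by exact: L2Z.
have gZ h : L2 mu h -> inner mu g h = (((l2norm mu f)^-1)%:C)%C * inner mu f h.
  move=> Lh; have L0 := L2_cst mu (0 : C).
  have := inner_linl ((((l2norm mu f)^-1)%:C)%C) Lf L0 Lh.
  rewrite inner0l addr0 => <-; congr inner.
  by apply/funext => x; rewrite addr0.
have gE e : E e -> inner mu g e = 0.
  by move=> Ee; rewrite gZ ?fE ?mulr0//; exact: EL.
have gg : inner mu g g = 1.
  rewrite gZ// (inner_conj Lg Lf) gZ// innerff// -rmorphM conjc_real -rmorphM.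
  by rewrite expr2 mulKf// mulVf.
have nEg : ~ E g.
  by move=> /gE /eqP; rewrite gg oner_eq0.
apply: (Emax (E `|` [set g])).
  split; first by move=> x; left.
  by move=> /(_ g (or_intror erefl)).
split => [e [/EL//|->//]|e e' [Ee|->] [Ee'|->]].
- exact: Eo.
- rewrite (inner_conj Lg (EL _ Ee)) gE// conjc0; case: asboolP => // eg.
  by case: nEg; rewrite -eg.
- rewrite gE//; case: asboolP => // eg.
  by case: nEg; rewrite eg.
- by rewrite gg; case: asboolP.
Qed.

Lemma some_ONB_ONB : ONB mu (some_ONB mu).
Proof. exact: (xgetPex set0 exists_ONB). Qed.

(** Unlike the factor 2 of [sqabsD_le], the factor of z tends to 1 with d, so that no constant is
    lost in the limit. The two squares below encode 2ac <= d a^2 + c^2 / d for each coordinate. *)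
Let sqabsD_delta (z w : C) (d : R) : 0 < d ->
  sqabs (z + w) <= (1 + d) * sqabs z + (1 + d^-1) * sqabs w.
Proof.
move=> d0; case: z => a b; case: w => c e; rewrite /sqabs /=.
have := sqr_ge0 (d * a - c); have := sqr_ge0 (d * b - e).
have k0 : 0 < d^-1 by rewrite invr_gt0.
have dk : d * d^-1 = 1 by rewrite divff// gt_eqF.
move: (d^-1) k0 dk => k k0 dk h1 h2.
have := mulr_ge0 (ltW k0) h1; have := mulr_ge0 (ltW k0) h2.
have -> : k * (d * a - c) ^+ 2 = (d * k) * d * a ^+ 2 - 2 * (d * k) * a * c + k * c ^+ 2.
  by ring.
have -> : k * (d * b - e) ^+ 2 = (d * k) * d * b ^+ 2 - 2 * (d * k) * b * e + k * e ^+ 2.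
  by ring.
by rewrite dk => *; lra.
Qed.

Lemma nrm2D_delta (f g : B -> C) (d : R) : 0 < d -> L2 mu f -> L2 mu g ->
  (nrm2 mu (fun x => (f x + g x)%R) <=
   (1 + d)%:E * nrm2 mu f + (1 + d^-1)%:E * nrm2 mu g)%E.
Proof.
move=> d0 Lf Lg; have d1 : 0 <= 1 + d by rewrite addr_ge0// ltW.
have d2 : 0 <= 1 + d^-1 by rewrite addr_ge0// invr_ge0 ltW.
have mf := emeasurable_sqabs (L2_cmeas Lf); have mg := emeasurable_sqabs (L2_cmeas Lg).
rewrite /nrm2 -!ge0_integralZl_EFin//; try by move=> x _; rewrite lee_fin sqabs_ge0.
rewrite -ge0_integralD//.
- apply: ge0_le_integral => //.
  + by move=> x _; rewrite lee_fin sqabs_ge0.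
  + exact: (emeasurable_sqabs (L2_cmeas (L2D Lf Lg))).
  + by apply: emeasurable_funD; exact: measurable_funeM.
  + by move=> x _; rewrite -!EFinM -EFinD lee_fin sqabsD_delta.
- by move=> x _; rewrite -EFinM lee_fin mulr_ge0 ?sqabs_ge0.
- exact: measurable_funeM.
- by move=> x _; rewrite -EFinM lee_fin mulr_ge0 ?sqabs_ge0.
- exact: measurable_funeM.
Qed.

Lemma esum_fset_le (E : set (B -> C)) (A : {fset (B -> C)}) (a : (B -> C) -> \bar R) :
  [set` A] `<=` E -> (\sum_(e <- A) a e <= \esum_(e in E) a e)%E.
Proof.
move=> AE; apply: esum_ge; exists [set` A]; first by split.
by rewrite fsbig_finite//= set_fsetK.
Qed.

Section OrthonormalFamily.
Variables (E : set (B -> C)) (I : finType) (g : I -> B -> C) (T : (B -> C) -> (B -> C)).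
Hypotheses (ONB_E : ONB mu E) (og : orthonormal_family mu g) (bT : bounded_op mu T).

Let Lg := og.1.
Let LT f : L2 mu f -> L2 mu (T f). Proof. by case: bT => + _ _ _; apply. Qed.
Let LE e : E e -> L2 mu e. Proof. by case: ONB_E => + _ _; apply. Qed.

(* Bessel's inequality for the vector [\sum_e (t e)^* e] *)
Let bessel_coef (A : {fset (B -> C)}) (t : (B -> C) -> C) : [set` A] `<=` E ->
  \sum_i sqabs (\sum_(e <- A) inner mu (g i) e * t e) <= \sum_(e <- A) sqabs (t e).
Proof.
move=> AE; pose w x := \sum_(e <- A) (t e)^*%C * e x.
have Lw : L2 mu w by exact: (L2_fset ONB_E (fun e => (t e)^*%C) AE).
have := bessel og Lw; rewrite (nrm2_fset ONB_E (fun e => (t e)^*%C) AE) lee_fin.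
under [in X in _ <= X -> _]eq_bigr do rewrite sqabsJ.
apply: le_trans; rewrite le_eqVlt; apply/orP; left; apply/eqP.
apply: eq_bigr => i _; rewrite -[in RHS]sqabsJ; congr sqabs.
have oA := orthonormal_fset ONB_E AE.
have -> : w = (fun x => \sum_(e : A) (t (val e))^*%C * val e x).
  by apply/funext => x; rewrite /w big_seq_fsetE.
rewrite inner_suml; [|exact: oA.1|exact: Lg].
rewrite big_seq_fsetE rmorph_sum; apply: eq_bigr => e _.
by rewrite (inner_conj (oA.1 e) (Lg i)) mulrC -[t _ in LHS]conjcK -rmorphM.
Qed.

(** Almost everywhere T of the i-th projection is the sum of the [inner mu (g i) e * T e x]. At each
    x, [bessel_coef] with t e = T e x bounds the sum over i of the squares; integrating gives the
    claim. *)
Let finite_bound (A : {fset (B -> C)}) : [set` A] `<=` E ->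
  (\sum_i nrm2 mu (T (fun x => (\sum_(e <- A) inner mu (g i) e * e x)%R)) <=
   \esum_(e in E) nrm2 mu (T e))%E.
Proof.
move=> AE; apply: le_trans (esum_fset_le (fun e => nrm2 mu (T e)) AE).
have AE' (e : A) : L2 mu (val e) by exact/LE/AE/(fsvalP e).
pose S i x := \sum_(e <- A) inner mu (g i) e * T e x.
have LS i : L2 mu (S i).
  rewrite (_ : S i = fun x => \sum_(e : A) inner mu (g i) (val e) * T (val e) x).
    by apply: L2_sum => e; exact: LT.
  by apply/funext => x; rewrite /S big_seq_fsetE.
have -> : (\sum_i nrm2 mu (T (fun x => (\sum_(e <- A) inner mu (g i) e * e x)%R)) =
    \sum_i nrm2 mu (S i))%E.
  apply: eq_bigr => i _; apply: nrm2_ae; last 1 first.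
  - rewrite (_ : (fun x => _) = fun x => \sum_(e : A) inner mu (g i) (val e) * val e x).
      apply: aeq_trans (bounded_op_sum _ _ bT AE') _; apply/aeqP; apply: aeW => x.
      by rewrite /S big_seq_fsetE.
    by apply/funext => x; rewrite big_seq_fsetE.
  - by apply: L2_cmeas; apply: LT; exact: (L2_fset ONB_E (fun e => inner mu (g i) e) AE).
  - exact: L2_cmeas.
rewrite big_seq_fsetE/= /nrm2 -!ge0_integral_sum//; last 4 first.
- by move=> e; apply: emeasurable_sqabs; exact: (L2_cmeas (LT (AE' e))).
- by move=> e x _; rewrite lee_fin sqabs_ge0.
- by move=> i; apply: emeasurable_sqabs; exact: L2_cmeas.
- by move=> i x _; rewrite lee_fin sqabs_ge0.
apply: ge0_le_integral => //.
- by move=> x _; apply: sume_ge0 => i _; rewrite lee_fin sqabs_ge0.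
- by apply: emeasurable_sum => i; apply: emeasurable_sqabs; exact: L2_cmeas.
- by apply: emeasurable_sum => e; apply: emeasurable_sqabs; exact: (L2_cmeas (LT (AE' e))).
- move=> x _; rewrite !sumEFin lee_fin.
  have := bessel_coef (fun e => T e x) AE.
  by rewrite [leRHS]big_seq_fsetE.
Qed.

(** Each [g i] is replaced by its projection onto a finite part of E, where [finite_bound] applies;
    boundedness of T controls the error, which is then sent to 0. *)
Lemma HS_orthonormal_le :
  (\sum_i nrm2 mu (T (g i)) <= \esum_(e in E) nrm2 mu (T e))%E.
Proof.
have S0 : (0 <= \esum_(e in E) nrm2 mu (T e))%E.
  by apply: esum_ge0 => e _; exact: nrm2_ge0.
have [->|Sfin] := eqVneq (\esum_(e in E) nrm2 mu (T e))%E +oo%E; first exact: leey.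
have {Sfin} : (\esum_(e in E) nrm2 mu (T e))%E \is a fin_num.
  by rewrite ge0_fin_numE// ltey.
move: S0 finite_bound; case: (\esum_(e in E) _)%E => // s; rewrite lee_fin => s0 fb _.
have [M M0 TM] := bounded_op_nrm2 bT.
(* The final bound is (1 + d) s + |I| (d + d^2) M, at most s + d K because d^2 <= d; the 1 ensures K
   > 0. *)
pose K := s + 2 * (#|I|%:R * M) + 1.
have K0 : 0 < K by rewrite ltr_wpDl// addr_ge0// !mulr_ge0// ltW.
apply/lee_addgt0Pr => eps eps0.
pose d := Num.min 1 (eps / K).
have d0 : 0 < d by rewrite lt_min ltr01 divr_gt0.
have d1 : d <= 1 by rewrite ge_min lexx.
have dK : d * K <= eps by rewrite -ler_pdivlMr// ge_min lexx orbT.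
(* The tolerance is d^2 because [nrm2D_delta] multiplies the error by 1 + 1/d, which leaves d +
   d^2. *)
have dd0 : 0 < d ^+ 2 by rewrite exprn_gt0.
have /choice[A PA] : forall i, exists A : {fset (B -> C)}, [set` A] `<=` E /\
    (nrm2 mu (fun x => (g i x - \sum_(e <- A) inner mu (g i) e * e x)%R) <= (d ^+ 2)%:E)%E.
  by move=> i; have [A ? ?] := ONB_dense ONB_E (Lg i) dd0; exists A.
(* [finite_bound] needs one finite set for all i; passing from [A i] to the union does not increase
   the residual. *)
pose D := \big[@fsetU _/fset0]_(i : I) A i.
have DE : [set` D] `<=` E.
  by move=> x /= /bigfcupP[i _ xA]; exact: (PA i).1.
pose p i x := \sum_(e <- D) inner mu (g i) e * e x.
have Lp i : L2 mu (p i) by exact: (L2_fset ONB_E (fun e => inner mu (g i) e) DE).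
have gp i : (nrm2 mu (fun x => (g i x - p i x)%R) <= (d ^+ 2)%:E)%E.
  apply: le_trans (PA i).2; rewrite !(nrm2_proj_fset ONB_E)//; last exact: (PA i).1.
  rewrite leeB// lee_fin (@big_fsetDsub _ _ (A i) D).
    by rewrite lerDl; apply: sumr_ge0 => e _; exact: sqabs_ge0.
  by apply: bigfcup_sup.
have Ti i : (nrm2 mu (T (g i)) <= (1 + d)%:E * nrm2 mu (T (p i)) + ((d + d ^+ 2) * M)%:E)%E.
  have -> : nrm2 mu (T (g i)) = nrm2 mu (fun x => T (p i) x + T (fun x => g i x - p i x) x).
    apply: nrm2_ae.
    - exact/L2_cmeas/LT.
    - by apply: cmeasurableD; apply: L2_cmeas; apply: LT => //; exact: L2B.
    - have /aeqP h := bounded_opN bT (Lg i) (Lp i).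
      by apply/aeqP; apply: filterS h => x ->; rewrite addrC subrK.
  apply: le_trans (nrm2D_delta d0 _ _) _; [exact: LT|by apply: LT; exact: L2B|].
  apply: leeD2l.
  rewrite (_ : ((d + d ^+ 2) * M)%:E = (1 + d^-1)%:E * (M%:E * (d ^+ 2)%:E))%E; last first.
    by rewrite -!EFinM; congr EFin; field; rewrite gt_eqF.
  rewrite lee_pmul2l ?lte_fin ?ltr_wpDl ?invr_gt0//.
  apply: le_trans (TM _ _) _; first exact: L2B.
  by rewrite lee_pmul2l ?lte_fin.
apply: (@le_trans _ _ (\sum_i ((1 + d)%:E * nrm2 mu (T (p i)) + ((d + d ^+ 2) * M)%:E))%E).
  by apply: lee_sum => i _.
rewrite big_split/= -ge0_sume_distrr; last by move=> i _; exact: nrm2_ge0.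
rewrite sumEFin sumr_const -[((_ * M) *+ _)%R]mulr_natl.
apply: (@le_trans _ _ ((1 + d)%:E * s%:E + (#|I|%:R * ((d + d ^+ 2) * M))%:E)%E).
  apply: leeD2r; rewrite lee_pmul2l ?lte_fin ?ltr_wpDl//; exact: fb.
rewrite -EFinM -!EFinD lee_fin.
have dd : d ^+ 2 <= d by rewrite expr2 ler_piMl// ltW.
have N0 : 0 <= #|I|%:R * M by rewrite mulr_ge0// ltW.
move: dK; rewrite /K => dK.
rewrite [_ * (_ * M)]mulrCA; nra.
Qed.

End OrthonormalFamily.
End HilbertSchmidt.

(** * Averaging over the Haar measure *)

Section CompactGroup.
Context {G : ptopologicalType} (grp : compact_group G).
Local Notation B := (borel_of G).
Local Notation m := (cg_mul grp).
Local Notation "x ^^-1" := (cg_inv grp x) (at level 3, format "x ^^-1").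
Local Notation one := (cg_one grp).

Lemma cg_mulgV x : m x x^^-1 = one.
Proof.
set y := x^^-1; have -> : m x y = m (m y^^-1 y) (m x y) by rewrite cg_mulVg cg_mul1g.
by rewrite -cg_mulA [m y _]cg_mulA cg_mulVg cg_mul1g cg_mulVg.
Qed.

Lemma cg_mulg1 x : m x one = x.
Proof. by rewrite -(cg_mulVg grp x) cg_mulA cg_mulgV cg_mul1g. Qed.

Lemma cg_mulKg x y : m x^^-1 (m x y) = y.
Proof. by rewrite cg_mulA cg_mulVg cg_mul1g. Qed.

Lemma cg_mulVKg x y : m x (m x^^-1 y) = y.
Proof. by rewrite cg_mulA cg_mulgV cg_mul1g. Qed.

Lemma cg_invK x : x^^-1^^-1 = x.
Proof. by rewrite -[LHS]cg_mulg1 -(cg_mulVg grp x) cg_mulKg. Qed.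

Lemma cg_invM x y : (m x y)^^-1 = m y^^-1 x^^-1.
Proof.
rewrite -[RHS](cg_mulKg (m x y)) -cg_mulA [m y _]cg_mulA cg_mulgV cg_mul1g.
by rewrite cg_mulgV cg_mulg1.
Qed.

(** The translate xA as a preimage, so that its measurability follows from continuity. *)
Definition ltrans (x : G) (A : set B) : set B := [set y | A (m x^^-1 y)].

Lemma ltrans_image x (A : set B) : [set m x a | a in A] = ltrans x A.
Proof.
apply/seteqP; split => [_ [a Aa <-]|y Ay]; first by rewrite /ltrans/= cg_mulKg.
by exists (m x^^-1 y) => //; rewrite cg_mulVKg.
Qed.

Definition set_inv (A : set B) : set B := [set y | A (y^^-1)].

Lemma set_invK A : set_inv (set_inv A) = A.
Proof. by apply/seteqP; split => x; rewrite /set_inv/= cg_invK. Qed.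

Lemma set_inv_image (A : set B) : [set x^^-1 | x in A] = set_inv A.
Proof.
apply/seteqP; split => [_ [a Aa <-]|y Ay]; first by rewrite /set_inv/= cg_invK.
by exists y^^-1 => //; rewrite cg_invK.
Qed.

Lemma cg_ltrans_cont x : continuous (m x : G -> G).
Proof.
move=> y; apply: (@continuous_comp _ _ _ (fun y => (x, y)) (fun p => m p.1 p.2)).
  by apply: cvg_pair; [exact: cvg_cst|exact: cvg_id].
exact: cg_mul_cont.
Qed.

Lemma borel_measurable_continuous (f : G -> G) : continuous f ->
  measurable_fun [set: B] (f : B -> B).
Proof.
move=> cf; apply: (@measurability _ _ B B setT f (@open G)) => //.
move=> _ [A oA <-]; rewrite setTI; apply: sub_sigma_algebra.
by move/continuousP : cf; apply.
Qed.

Lemma borel_open (U : set B) : open (U : set G) -> measurable U.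
Proof. exact: sub_sigma_algebra. Qed.

Lemma borel_compact (K : set B) : compact (K : set G) -> measurable K.
Proof.
move=> /(compact_closed (cg_hausdorff grp)) /closed_openC /borel_open mK.
by rewrite -(setCK K); exact: measurableC.
Qed.

Lemma measurable_ltrans x (A : set B) : measurable A -> measurable (ltrans x A).
Proof.
move=> mA; have := borel_measurable_continuous (@cg_ltrans_cont x^^-1) measurableT mA.
by rewrite setTI.
Qed.

Lemma measurable_set_inv (A : set B) : measurable A -> measurable (set_inv A).
Proof.
move=> mA; have := borel_measurable_continuous (@cg_inv_cont _ grp) measurableT mA.
by rewrite setTI.
Qed.

Lemma open_set_inv (U : set B) : open (U : set G) -> open (set_inv U : set G).
Proof. by move=> oU; have /continuousP := @cg_inv_cont _ grp; exact. Qed.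

Lemma compact_set_inv (K : set B) : compact (K : set G) -> compact (set_inv K : set G).
Proof.
move=> cK; rewrite -set_inv_image; apply: (@continuous_compact G G (cg_inv grp) K) => //.
by apply: continuous_subspaceT; exact: cg_inv_cont.
Qed.

(** Tube lemma: (k, x) -> x0^-1 x k is continuous and maps K at x = x0 into the open set U. Hence xK
    lies in x0 U for all x near x0. *)
Lemma near_ltrans_sub (x0 : G) (K U : set G) : compact K -> open U -> K `<=` U ->
  nbhs x0 [set x | forall k, K k -> U (m x0^^-1 (m x k))].
Proof.
move=> /compact_near_coveringP cK oU KU.
apply: (cK G (nbhs x0) (fun x k => U (m x0^^-1 (m x k)))) => k Kk.
pose f (p : G * G) := m x0^^-1 (m p.2 p.1).
have cf : continuous f.
  move=> p; apply: (@continuous_comp _ _ _ (fun p : G * G => m p.2 p.1) (m x0^^-1)).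
    apply: (@continuous_comp _ _ _ (fun p : G * G => (p.2, p.1)) (fun p => m p.1 p.2)).
      by apply: cvg_pair; [exact: cvg_snd|exact: cvg_fst].
    exact: cg_mul_cont.
  exact: cg_ltrans_cont.
apply: (cf (k, x0) U); apply: open_nbhs_nbhs; split => //.
by rewrite /f/= cg_mulKg; exact: KU.
Qed.

(** * Invariant integration and averages over translates *)

Section Haar.
Context {R : realType} (mu : probability B R).
Hypothesis haar : is_haar grp mu.

Lemma haar_ltrans x (A : set B) : measurable A -> mu (ltrans x A) = mu A.
Proof. by move=> mA; case: haar => h _ _; rewrite -(h x A mA) ltrans_image. Qed.

Lemma integral_ltrans x (f : B -> \bar R) : measurable_fun setT f ->
  (forall y, 0 <= f y)%E ->
  (\int[mu]_y f (m x^^-1 y) = \int[mu]_y f y)%E.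
Proof.
move=> mf f0; have mt := borel_measurable_continuous (@cg_ltrans_cont x^^-1).
rewrite -[LHS](@ge0_integral_pushforward _ _ _ _ _ (m x^^-1 : B -> B) mt mu setT f)//.
apply: eq_measure_integral => A mA _; exact: haar_ltrans.
Qed.

Lemma Rintegral_ltrans x (f : B -> R) :
  mu.-integrable setT (EFin \o f) ->
  Rintegral mu setT (fun y => f (m x^^-1 y)) = Rintegral mu setT f.
Proof.
move=> intf; have mt := borel_measurable_continuous (@cg_ltrans_cont x^^-1).
have mf : measurable_fun setT (EFin \o f) by case/integrableP : intf.
rewrite /Rintegral; congr fine.
rewrite -[LHS](@integral_pushforward _ _ B B _ (m x^^-1 : B -> B) mt mu setT (EFin \o f))//.
  by apply: eq_measure_integral => A mA _; exact: haar_ltrans.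
apply/integrableP; split; first exact: measurableT_comp.
have := @integral_ltrans x (fun y => `|(f y)%:E|)%E => /= -> //.
  by case/integrableP : intf.
by apply/measurable_EFinP; apply: measurableT_comp => //; exact/measurable_EFinP.
Qed.

(* Averages [x |-> \int_(xU) h] over [x].  The Borel sigma-algebra of [G * G] may be
   strictly larger than the product one, so Fubini is replaced by a finite partition
   of [G] on each piece of which [xK] stays inside a fixed translate of [U]. *)
Lemma exists_ltrans_ge (K U : set B) (h : B -> \bar R) :
  compact (K : set G) -> open (U : set G) -> K `<=` U ->
  measurable_fun setT h -> (forall y, 0 <= h y)%E ->
  exists x, (mu (set_inv K) * \int[mu]_y h y <= \int[mu]_(y in ltrans x U) h y)%E.
Proof.
move=> cK oU KU mh h0.
pose W (x0 : G) := [set x | forall k, K k -> U (m x0^^-1 (m x k))]^°.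
have : cover_compact [set: G] by rewrite -compact_cover; exact: (cg_compact grp).
case/(_ G setT W) => [x _|x _|D' _ cD].
- exact: open_interior.
- exists x => //; exact: near_ltrans_sub.
pose n := size (enum_fset D'); pose X i := nth point (enum_fset D') i.
pose A := seqDU (fun i => W (X i) : set B).
have mA i : measurable (A i).
  by apply: seqDU_measurable => k; apply: borel_open; exact: open_interior.
have UA : \big[setU/set0]_(i < n) A i = setT.
  rewrite -bigsetU_seqDU -subTset => x _; have [x0 x0D Wx] := cD x I.
  have ix : (index x0 (enum_fset D') < n)%N by rewrite index_mem.
  by rewrite -(bigcup_mkord n (fun k => W (X k) : set B)); exists (index x0 (enum_fset D')) => //; rewrite /X nth_index.
have n0 : (0 < n)%N.
  rewrite lt0n; apply/eqP => n0; move: UA; rewrite n0 big_ord0 => /seteqP[_ /(_ point)].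
  by apply.
have sumA : (\sum_(i < n) mu (A i) = 1)%E.
  rewrite -(@probability_setT _ _ _ mu) -UA (@measure_semi_additive _ _ _ mu A n mA (trivIset_seqDU _))//.
  by rewrite UA.
(* The points x with y in xK form y K^-1, of measure mu(K^-1) by invariance. Such an x in the piece
   [A i] satisfies xK inside [X i] U, so y lies in the translate of U by [X i]. *)
have key y : (mu (set_inv K) <= \sum_(i < n) mu (A i) * (\1_(ltrans (X i) U) y)%:E)%E.
  pose B' i := if `[< ltrans (X i) U y >] then A i else set0.
  have mB i : measurable (B' i) by rewrite /B'; case: ifP.
  rewrite -(haar_ltrans y (measurable_set_inv (borel_compact cK))).
  apply: (@le_trans _ _ (mu (\big[setU/set0]_(i < n) B' i))).
    apply: le_measure.
    - apply: mem_set; exact: (measurable_ltrans _ (measurable_set_inv (borel_compact cK))).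
    - by apply: mem_set; exact: bigsetU_measurable.
    - move=> x; rewrite /ltrans /set_inv /= cg_invM cg_invK => Kx.
      have : (\big[setU/set0]_(i < n) A i) x by rewrite UA.
      rewrite -!bigcup_mkord => -[i /= ltin Aix]; exists i => //.
      have /interior_subset/(_ _ Kx) := subset_seqDU Aix.
      by rewrite /B' cg_mulVKg => Uy; case: asboolP.
  apply: (le_trans (@Boole_inequality _ _ _ mu B' n (fun i _ => mB i))); apply: lee_sum => i _.
  rewrite /B' indicE; case: asboolP => [xU|nxU]; first by rewrite mem_set// mule1.
  by rewrite memNset// mule0 measure0.
pose L i : \bar R := (\int[mu]_(y in ltrans (X i) U) h y)%E.
have L_indic i : L i = (\int[mu]_y ((\1_(ltrans (X i) U) y)%:E * h y))%E.
  rewrite /L integral_mkcond; apply: eq_integral => y _.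
  by rewrite patchE indicE; case: ifP => _ /=; rewrite ?mul1e ?mul0e.
have ml i : measurable (ltrans (X i) U) by exact: (measurable_ltrans _ (borel_open oU)).
have m1 i : measurable_fun setT (fun y => ((\1_(ltrans (X i) U) y)%:E * h y)%E).
  apply: emeasurable_funM => //; apply/measurable_EFinP; exact: measurable_indic.
have sumL : (mu (set_inv K) * \int[mu]_y h y <= \sum_(i < n) mu (A i) * L i)%E.
  have -> : (\sum_(i < n) mu (A i) * L i =
     \int[mu]_y (\sum_(i < n) mu (A i) * ((\1_(ltrans (X i) U) y)%:E * h y)))%E.
    rewrite ge0_integral_sum//.
    - apply: eq_bigr => i _; rewrite L_indic ge0_integralZl//.
      by move=> y _; rewrite mule_ge0// lee_fin.
    - by move=> i; exact: measurable_funeM.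
    - by move=> i y _; rewrite !mule_ge0// lee_fin.
  rewrite -ge0_integralZl//; apply: ge0_le_integral => //.
  - by move=> y _; rewrite mule_ge0.
  - exact: measurable_funeM.
  - by apply: emeasurable_sum => i; exact: measurable_funeM.
  - move=> y _; under eq_bigr do rewrite muleA.
    rewrite -ge0_sume_distrl; last by move=> i _; rewrite mule_ge0// lee_fin.
    exact: lee_wpmul2r.
(* The weights [mu (A i)] sum to 1, so the weighted average of the [L i] is at most their
   maximum. *)
have [i _ Lmax] := @arg_maxP _ _ _ (Ordinal n0) xpredT (fun i : 'I_n => L i) erefl.
exists (X i); apply: (le_trans sumL).
apply: (@le_trans _ _ (\sum_(j < n) mu (A j) * L i)%E).
  by apply: lee_sum => j _; rewrite lee_wpmul2l//; exact: Lmax.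
rewrite -ge0_sume_distrl; last by move=> j _.
by rewrite sumA mul1e.
Qed.

Let mu_fin (A : set B) : measurable A -> mu A \is a fin_num.
Proof. by move=> mA; exact: fin_num_measure. Qed.

Let inner_regular (U : set B) : open (U : set G) ->
  mu U = ereal_sup [set mu K | K in [set K : set B | compact (K : set G) /\ K `<=` U]].
Proof. by case: haar => _ _; apply. Qed.

(** For compact K inside U^-1, averaging h = 1 with K^-1 inside U yields mu(K) <= mu(xU) = mu(U);
    inner regularity of U^-1 concludes. *)
Let haar_inv_le (U : set B) : open (U : set G) -> (mu (set_inv U) <= mu U)%E.
Proof.
move=> oU; rewrite inner_regular; last exact: open_set_inv.
apply: ub_ereal_sup => _ [K [cK KU] <-].
have KU' : set_inv K `<=` U by move=> x /KU; rewrite /set_inv/= cg_invK.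
have [x] := @exists_ltrans_ge (set_inv K) U (cst 1%E) (compact_set_inv cK) oU KU'
  (measurable_cst _) (fun=> lee01).
rewrite set_invK integral_cst// integral_cst; last exact: (measurable_ltrans _ (borel_open oU)).
rewrite [X in (_ * (_ * X))%E](@probability_setT _ _ _ mu) !mule1 mul1e => h.
by apply: (le_trans h); rewrite le_eqVlt -(haar_ltrans x (borel_open oU)) eqxx.
Qed.

Lemma haar_set_inv (U : set B) : open (U : set G) -> mu (set_inv U) = mu U.
Proof.
move=> oU; apply/eqP; rewrite eq_le haar_inv_le//=.
by rewrite -{1}(set_invK U) haar_inv_le//; exact: open_set_inv.
Qed.

(** S is enlarged to an open U and U^-1 is shrunk to a compact K; each approximation costs e/2.
    [haar_set_inv] turns the mu(U^-1) produced by the averaging into mu(U) >= mu(S). *)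
Lemma exists_ltrans_integral_ge (S : set B) (h : B -> R) (e : R) :
  measurable S -> (forall y, 0 <= h y) -> mu.-integrable setT (EFin \o h) -> 0 < e ->
  exists x, (mu S * \int[mu]_y (h y)%:E <= \int[mu]_(y in ltrans x S) (h y)%:E + e%:E)%E.
Proof.
move=> mS h0 ih e0.
have e20 : 0 < e / 2 by rewrite divr_gt0.
have mh : measurable_fun setT (EFin \o h) by case/integrableP : ih.
have h0' y : (0 <= (h y)%:E)%E by rewrite lee_fin.
have If : (\int[mu]_y (h y)%:E)%E \is a fin_num by exact: integrable_fin_num.
(* Absolute continuity of the integral of h. The threshold d works for every x, although x is only
   found later, because all translates of U minus S have the same measure. *)
have [d [d0 hd]] := integral_normr_continuous ih e20.
have [_ [U [oU SU] <-] Ud] : exists2 x : \bar R,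
    [set mu U | U in [set U : set B | open (U : set G) /\ S `<=` U]] x & (x < mu S + d%:E)%E.
  have -> : mu S = ereal_inf [set mu U | U in [set U : set B | open (U : set G) /\ S `<=` U]].
    by case: haar => _ + _; apply.
  apply: lb_ereal_inf_adherent => //; case: haar => _ <- // _; exact: mu_fin.
have mU := borel_open oU.
have muUS : (mu (U `\` S) < d%:E)%E.
  rewrite measureD//; last by rewrite -ge0_fin_numE ?mu_fin.
  by rewrite (setIidr SU) lteBlDl// mu_fin.
pose I := fine (\int[mu]_y (h y)%:E)%E.
have I0 : 0 <= I by apply: fine_ge0; exact: integral_ge0.
(* The measure lost from U^-1 to K gets multiplied by the total integral I; dividing by I + 1 covers
   I = 0. *)
have d'0 : 0 < e / 2 / (I + 1) by rewrite divr_gt0// ltr_wpDl.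
have oU' := open_set_inv oU.
have [_ [K [cK KU] <-] Kd] : exists2 x : \bar R,
    [set mu K | K in [set K : set B | compact (K : set G) /\ K `<=` set_inv U]] x &
    (mu (set_inv U) - (e / 2 / (I + 1))%:E < x)%E.
  rewrite (inner_regular oU'); apply: ub_ereal_sup_adherent => //.
  by rewrite -inner_regular// mu_fin//; exact: borel_open.
have KU' : set_inv K `<=` U by move=> x /KU; rewrite /set_inv/= cg_invK.
have [x] := exists_ltrans_ge (compact_set_inv cK) oU KU' mh h0'.
rewrite set_invK => hx; exists x.
have mK := borel_compact cK.
have mxS := measurable_ltrans x mS.
have mxUS : measurable (ltrans x (U `\` S)) by apply: measurable_ltrans; exact: measurableD.
have split : (\int[mu]_(y in ltrans x U) (h y)%:E =
    \int[mu]_(y in ltrans x S) (h y)%:E + \int[mu]_(y in ltrans x (U `\` S)) (h y)%:E)%E.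
  rewrite -ge0_integral_setU//; last 2 first.
  - exact: measurable_funTS.
  - by apply/disj_setPS => y [/= ? []].
  congr integral; apply/seteqP; split => y /=; rewrite /ltrans/=.
    by move=> Uy; have [|] := pselect (S (m x^^-1 y)); [left|right].
  by case=> [/SU//|[]].
have small : (\int[mu]_(y in ltrans x (U `\` S)) (h y)%:E <= (e / 2)%:E)%E.
  have fi : (\int[mu]_(y in ltrans x (U `\` S)) (h y)%:E)%E \is a fin_num.
    by apply: integrable_fin_num => //; exact: integrableS ih.
  rewrite -(fineK fi) lee_fin.
  have lt : (mu (ltrans x (U `\` S)) < d%:E)%E.
    by rewrite haar_ltrans//; exact: measurableD.
  have /ltW := hd _ mxUS lt; apply: le_trans; rewrite /Rintegral le_eqVlt; apply/orP; left; apply/eqP.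
  by congr fine; apply: eq_integral => y _; rewrite ger0_norm.
apply: (@le_trans _ _ (mu K * \int[mu]_y (h y)%:E + (e / 2)%:E)%E); last first.
  rewrite [e in leRHS]splitr EFinD addeA; apply: leeD2r; apply: (le_trans hx).
  by rewrite split leeD2l.
have -> : (\int[mu]_y (h y)%:E)%E = I%:E by rewrite fineK.
have SU' : (mu S <= mu U)%E by exact: le_measure (mem_set mS) (mem_set mU) SU.
move: Kd SU'; rewrite haar_set_inv//.
rewrite -(fineK (mu_fin mK)) -(fineK (mu_fin mU)) -(fineK (mu_fin mS)).
rewrite -EFinB -!EFinM -EFinD lte_fin !lee_fin => Kd SU'.
rewrite (@le_trans _ _ ((fine (mu K) + e / 2 / (I + 1)) * I))//.
  by rewrite ler_wpM2r// (le_trans SU')// -lerBlDr ltW.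
have I1 : I / (I + 1) <= 1 by rewrite ler_pdivrMr ?ltr_wpDl// mul1r lerDl.
rewrite mulrDl lerD2l (_ : e / 2 / (I + 1) * I = e / 2 * (I / (I + 1))); last by ring.
by rewrite -[leRHS]mulr1 ler_wpM2l// ltW.
Qed.

End Haar.
End CompactGroup.

(** * Operators commuting with characteristic functions *)

Section Multiplication.
Context {R : realType} {G : ptopologicalType} (mu : probability (borel_of G) R).
Local Notation B := (borel_of G).
Local Notation C := R[i].

Lemma bounded_opZ T (a : C) f : bounded_op mu T -> L2 mu f ->
  aeq mu (T (fun x => a * f x)) (fun x => a * T f x).
Proof.
(* Writing a f as (a - 1) f + f fits the form of the linearity axiom without a zero summand. *)
move=> [_ _ Tlin _] Lf; have := Tlin (a - 1) f f Lf Lf.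
rewrite (_ : (fun x => (a - 1) * f x + f x) = (fun x => a * f x)); last first.
  by apply/funext => x; rewrite mulrBl mul1r subrK.
move/aeq_trans; apply; apply/aeqP; apply: aeW => x.
by rewrite mulrBl mul1r subrK.
Qed.

Section RoundDown.
Variables (eps : R) (f : B -> C).
Hypotheses (eps0 : 0 < eps) (mf : cmeasurable f).

Let fl (r : R) : R := (Num.floor (r / eps))%:~R.

Let mfl (u : B -> R) : measurable_fun setT u -> measurable_fun setT (fun x => fl (u x)).
Proof.
move=> mu_; apply: (@measurableT_comp _ _ _ _ _ _ fl) => //.
apply: nondecreasing_measurable => // r s rs.
by rewrite ler_int le_floor// ler_pM2r// invr_gt0.
Qed.

Let fl_dist r : `|r - eps * fl r| <= eps.
Proof.
have /andP[] := floor_itv (r / eps); rewrite intrD -/(fl r); move: (fl r) => q.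
rewrite ler_pdivlMr// ltr_pdivrMr// mulrDl mul1r (mulrC q) => h1 h2.
have e0 := eps0; move: (eps * q) h1 h2 => t h1 h2.
by rewrite ler_norml; apply/andP; split; lra.
Qed.

(** A uniform approximation of f, which may be unbounded, hence countably many values. Uniformity
    matters because p is only known to be in L^2, so p (f - s) is small once f - s is uniformly
    small. *)
Definition round_down x : C :=
  (eps * fl (complex.Re (f x)) +i* (eps * fl (complex.Im (f x))))%C.

Definition round_cell (ij : int * int) : set B :=
  (fun x => fl (complex.Re (f x))) @^-1` [set ij.1%:~R] `&`
  (fun x => fl (complex.Im (f x))) @^-1` [set ij.2%:~R].

Lemma cmeasurable_round_down : cmeasurable round_down.
Proof. by split; apply: measurable_funM => //; apply: mfl; case: mf. Qed.

Lemma measurable_round_cell ij : measurable (round_cell ij).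
Proof.
by apply: measurableI; rewrite -[X in measurable X]setTI;
  apply: mfl => //; case: mf.
Qed.

Lemma round_cell_cover x : exists ij, round_cell ij x.
Proof.
by exists (Num.floor (complex.Re (f x) / eps), Num.floor (complex.Im (f x) / eps)).
Qed.

Lemma round_downE ij x : round_cell ij x ->
  round_down x = (eps * ij.1%:~R +i* (eps * ij.2%:~R))%C.
Proof. by rewrite /round_down => -[/= -> ->]. Qed.

Lemma sqabs_round_down x : sqabs (f x - round_down x) <= 2 * eps ^+ 2.
Proof.
rewrite /round_down; case: (f x) => a b; rewrite /sqabs /=.
have sq t : `|t| <= eps -> t ^+ 2 <= eps ^+ 2.
  move=> h; rewrite -real_normK ?num_real//.
  by rewrite lerXn2r ?nnegrE ?(ltW eps0).
by have := sq _ (fl_dist a); have := sq _ (fl_dist b); lra.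
Qed.

End RoundDown.

Section CommutesWithChi.
Variable P : (B -> C) -> (B -> C).
Hypothesis bP : bounded_op mu P.
Hypothesis Pchi : forall S : set B, measurable S -> forall g, L2 mu g ->
  aeq mu (P (fun y => chi S y * g y)) (fun y => chi S y * P g y).

Let p := P (fun=> 1).
Let LP f : L2 mu f -> L2 mu (P f). Proof. by case: bP => + _ _ _; apply. Qed.
Let Lp : L2 mu p. Proof. exact/LP/L2_cst. Qed.

(* On each of the countably many cells [round_down eps f] is a constant, so [P] acts there as
   on a characteristic function. *)
Lemma multiplication_round_down (eps : R) f : 0 < eps -> L2 mu f -> L2 mu (round_down eps f) ->
  aeq mu (P (round_down eps f)) (fun x => p x * round_down eps f x).
Proof.
move=> eps0 Lf Ls; set s := round_down eps f in Ls *.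
have cell ij : {ae mu, forall x, round_cell eps f ij x -> P s x = p x * s x}.
  have mS := measurable_round_cell eps0 (L2_cmeas Lf) ij.
  set S := round_cell eps f ij in mS *.
  pose c := (eps * ij.1%:~R +i* (eps * ij.2%:~R))%C : C.
  have L1 := L2_cst mu (1 : C); have LS := L2_chiM mS L1.
  have sE : (fun y => chi S y * s y) = (fun y => c * (chi S y * (fun=> 1) y)).
    apply/funext => y; rewrite mulr1 mulrC /chi; case: asboolP => [Sy|_]; last by rewrite !mulr0.
    by rewrite /s (round_downE Sy).
  have /aeqP e1 := Pchi mS Ls; have /aeqP e2 := Pchi mS L1.
  have /aeqP e3 := bounded_opZ c bP LS.
  apply: filterS3 e1 e2 e3 => x; rewrite sE => -> -> h Sx.
  have Sx1 : chi S x = 1 :> C by rewrite /chi asboolT.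
  move: h; rewrite Sx1 !mul1r => ->.
  by rewrite mulrC /s (round_downE Sx).
apply/aeqP.
(* Pairs of integers are enumerated by natural numbers, so that countably many null sets can be
   discarded at once. *)
have : {ae mu, forall x, forall n : nat, if pickle_inv n is Some ij then
    round_cell eps f ij x -> P s x = p x * s x else True}.
  by apply: ae_foralln => n; case: (pickle_inv n) => [ij|]; [exact: cell|exact: aeW].
apply: filterS => x h; have [ij xij] := round_cell_cover eps f x.
by have := h (choice.pickle ij); rewrite pickleK_inv; exact.
Qed.

(** With s the rounding of f, P f - p f equals P (f - s) + p (s - f) almost everywhere. The first
    term is small by boundedness of P, the second because s - f is uniformly small and p lies in
    L^2. *)
Lemma multiplication_op f : L2 mu f -> aeq mu (P f) (fun x => p x * f x).
Proof.
move=> Lf; have mpf : cmeasurable (fun x => p x * f x).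
  by apply: cmeasurableM; [exact: (L2_cmeas Lp)|exact: (L2_cmeas Lf)].
apply: (nrm2B_eq0 (L2_cmeas (LP Lf)) mpf); apply: nrm2_eps => e e0.
have [M M0 PM] := bounded_op_nrm2 bP.
pose N := l2norm mu p ^+ 2.
have N0 : 0 <= N by exact: sqr_ge0.
(* Chosen so that the final bound, 4 (M + N) eps^2, is exactly e. *)
pose eps := Num.sqrt (e / (4 * (M + N))).
have MN0 : 0 < 4 * (M + N) by rewrite mulr_gt0// ltr_wpDr.
have eps0 : 0 < eps by rewrite sqrtr_gt0 divr_gt0.
have eps2 : eps ^+ 2 = e / (4 * (M + N)) by rewrite sqr_sqrtr// divr_ge0 ?ltW.
pose s := round_down eps f.
have ms : cmeasurable s by exact: (cmeasurable_round_down eps0 (L2_cmeas Lf)).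
have mfs : cmeasurable (fun x => f x - s x) by exact: (cmeasurableB (L2_cmeas Lf) ms).
have fs x : sqabs (f x - s x) <= sqabs (eps +i* eps)%C.
  by rewrite (le_trans (sqabs_round_down f eps0 x))// /sqabs /=; lra.
have Lfs : L2 mu (fun x => f x - s x) by exact: (L2_le mfs fs (L2_cst mu _)).
have Ls : L2 mu s.
  rewrite (_ : s = fun x => f x - (f x - s x)); first exact: L2B.
  by apply/funext => x; rewrite subKr.
have nfs : (nrm2 mu (fun x => (f x - s x)%R) <= (2 * eps ^+ 2)%:E)%E.
  apply: (le_trans (nrm2_le mu (cmeasurable_cst _) fs mfs)).
  rewrite /nrm2 integral_cst// [X in (_ * X)%E](@probability_setT _ _ _ mu) mule1 lee_fin.
  by rewrite /sqabs/=; lra.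
have mpfs : cmeasurable (fun x => p x * (s x - f x)).
  by apply: cmeasurableM; [exact: (L2_cmeas Lp)|apply: cmeasurableB => //; exact: (L2_cmeas Lf)].
have LPfs := LP Lfs.
have -> : nrm2 mu (fun x => P f x - p x * f x) =
    nrm2 mu (fun x => P (fun y => f y - s y) x + p x * (s x - f x)).
  apply: nrm2_ae.
  - by apply: cmeasurableB => //; exact: (L2_cmeas (LP Lf)).
  - exact: (cmeasurableD (L2_cmeas LPfs) mpfs).
  - have /aeqP h1 := bounded_opN bP Lf Ls.
    have /aeqP h2 := multiplication_round_down eps0 Lf Ls.
    apply/aeqP; apply: filterS2 h1 h2 => x -> ->.
    by rewrite -/s mulrBr addrA subrK.
apply: le_trans (nrm2D_le mu (L2_cmeas LPfs) mpfs) _.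
have b1 : (nrm2 mu (P (fun y => (f y - s y)%R)) <= (M * (2 * eps ^+ 2))%:E)%E.
  by apply: (le_trans (PM _ Lfs)); rewrite EFinM lee_pmul2l ?lte_fin.
have b2 : (nrm2 mu (fun x => (p x * (s x - f x))%R) <= (2 * eps ^+ 2 * N)%:E)%E.
  pose c := ((Num.sqrt (2 * eps ^+ 2))%:C)%C : C.
  have c2 : sqabs c = 2 * eps ^+ 2 by rewrite sqabsR sqr_sqrtr// mulr_ge0// sqr_ge0.
  have Lcp : L2 mu (fun x => c * p x) by exact: L2Z.
  apply: (@le_trans _ _ (nrm2 mu (fun x => c * p x))).
    apply: nrm2_le => //; first exact: (L2_cmeas Lcp).
    move=> x; rewrite !sqabsM c2 mulrC ler_wpM2r ?sqabs_ge0//.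
    by rewrite -sqabsN opprB; exact: sqabs_round_down.
  by rewrite nrm2Z; [rewrite c2 EFinM (nrm2E Lp)|exact: (L2_cmeas Lp)].
apply: (@le_trans _ _ (2 * (M * (2 * eps ^+ 2) + 2 * eps ^+ 2 * N))%:E).
  rewrite EFinM [X in (_ <= _ * X)%E]EFinD; apply: lee_wpmul2l; first by rewrite lee_fin.
  exact: leeD.
rewrite lee_fin (_ : 2 * (M * (2 * eps ^+ 2) + 2 * eps ^+ 2 * N) =
    eps ^+ 2 * (4 * (M + N))); last by ring.
by rewrite eps2 divfK// gt_eqF.
Qed.

End CommutesWithChi.
End Multiplication.

(** * Operator norms *)

Section EsumExtra.
Context {R : realType} {T : choiceType}.
Implicit Types (E : set T) (a : T -> \bar R).

Lemma esum_le_fset E a (y : \bar R) :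
  (forall A : {fset T}, [set` A] `<=` E -> (\sum_(e <- A) a e <= y)%E) ->
  (\esum_(e in E) a e <= y)%E.
Proof.
move=> h; apply: ub_ereal_sup => _ [F [finF FE] <-].
by rewrite fsbig_finite//=; apply: h; rewrite fset_setK.
Qed.

(** For r > 0 one divides by r; r = 0 is separate, as the sum may be infinite and the product is
    then 0. *)
Lemma le_mul_esum E a (r : R) (y : \bar R) : 0 <= r -> (0 <= y)%E ->
  (forall A : {fset T}, [set` A] `<=` E -> (r%:E * \sum_(e <- A) a e <= y)%E) ->
  (r%:E * (\esum_(e in E) a e) <= y)%E.
Proof.
move=> r0 y0 h; have [->|rneq0] := eqVneq r 0; first by rewrite mul0e.
have rgt0 : 0 < r by rewrite lt_neqAle eq_sym rneq0.
rewrite -lee_pdivlMl//; apply: esum_le_fset => A AE.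
by rewrite lee_pdivlMl//; exact: h.
Qed.

Lemma esumZl E a (r : R) : 0 <= r -> (forall e, 0 <= a e)%E ->
  (\esum_(e in E) (r%:E * a e) = r%:E * (\esum_(e in E) a e))%E.
Proof.
move=> r0 a0; apply/eqP; rewrite eq_le; apply/andP; split.
  apply: esum_le_fset => A AE; rewrite -ge0_sume_distrr//.
  apply: lee_wpmul2l; first by rewrite lee_fin.
  apply: esum_ge; exists [set` A]; first by split.
  by rewrite fsbig_finite//= set_fsetK.
apply: le_mul_esum => //; first by apply: esum_ge0 => e Ee; rewrite mule_ge0// lee_fin.
move=> A AE; rewrite ge0_sume_distrr//.
apply: esum_ge; exists [set` A]; first by split.
by rewrite fsbig_finite//= set_fsetK.
Qed.

End EsumExtra.

Section OperatorNorms.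
Context {R : realType} {G : ptopologicalType} (mu : probability (borel_of G) R).
Local Notation B := (borel_of G).
Local Notation C := R[i].

Lemma esqrt_le (x y : \bar R) : (x <= y)%E -> (esqrt x <= esqrt y)%E.
Proof.
case: x => [x| |]; case: y => [y| |] //=; rewrite ?lee_fin ?leey ?sqrtr_ge0//.
exact: ler_wsqrtr.
Qed.

Lemma esqrtM (r : R) (x : \bar R) : 0 <= r -> (0 <= x)%E ->
  esqrt (r%:E * x) = ((Num.sqrt r)%:E * esqrt x)%E.
Proof.
move=> r0; case: x => [x| |]//= x0; first by rewrite sqrtrM.
have [->|rneq0] := eqVneq r 0; first by rewrite mul0e sqrtr0 mul0e /= sqrtr0.
have rgt0 : 0 < r by rewrite lt_neqAle eq_sym rneq0.
by rewrite !gt0_muley// lte_fin// sqrtr_gt0.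
Qed.

Lemma esqrt_nrm2 f : L2 mu f -> (l2norm mu f)%:E = esqrt (nrm2 mu f).
Proof. by move=> Lf; rewrite (nrm2E Lf)/= sqrtr_sqr ger0_norm// l2norm_ge0. Qed.

Lemma HSnormE T : bounded_op mu T ->
  HSnorm mu T = esqrt (\esum_(e in some_ONB mu) nrm2 mu (T e))%E.
Proof.
move=> bT; congr esqrt; apply: eq_esum => e Ee.
rewrite nrm2E//; case: bT => + _ _ _; apply.
by case: (some_ONB_ONB mu) => + _ _; apply.
Qed.

Lemma bounded_op_comp P T : bounded_op mu P -> bounded_op mu T -> bounded_op mu (P \o T).
Proof.
move=> [PL Pae Plin [M PM]] [TL Tae Tlin [N TN]]; split.
- by move=> f Lf; exact/PL/TL.
- by move=> f g Lf Lg fg; apply: Pae; [exact: TL|exact: TL|exact: Tae].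
- move=> a f g Lf Lg; apply: aeq_trans (Plin _ _ _ (TL _ Lf) (TL _ Lg)).
  by apply: Pae; [apply: TL; exact: L2_lin|apply: L2_lin; exact: TL|exact: Tlin].
- exists (`|M| * N) => f Lf; apply: (le_trans (PM _ (TL _ Lf))).
  apply: (@le_trans _ _ (`|M| * l2norm mu (T f))).
    by rewrite ler_wpM2r ?l2norm_ge0// ler_norm.
  by rewrite -mulrA ler_wpM2l//; exact: TN.
Qed.

(** Allows [HS_orthonormal_le] to be applied to the operator chi_S T. *)
Lemma bounded_op_chiM S T : measurable S -> bounded_op mu T ->
  bounded_op mu (fun f x => chi S x * T f x).
Proof.
move=> mS [TL Tae Tlin [N TN]]; split.
- by move=> f Lf; apply: L2_chiM => //; exact: TL.
- move=> f g Lf Lg fg; have /aeqP h := Tae _ _ Lf Lg fg.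
  by apply/aeqP; apply: filterS h => x ->.
- move=> a f g Lf Lg; have /aeqP h := Tlin a _ _ Lf Lg.
  by apply/aeqP; apply: filterS h => x ->; rewrite mulrDr mulrCA.
- exists N => f Lf; apply: le_trans (TN _ Lf).
  have LTf := TL _ Lf; have LS := L2_chiM mS LTf.
  rewrite -lee_fin !esqrt_nrm2//; apply: esqrt_le.
  apply: nrm2_le; [exact: (L2_cmeas LTf)| |exact: (L2_cmeas LS)].
  by move=> x; rewrite sqabsM sqabs_chi ler_piMl ?sqabs_ge0// indicE lern1 leq_b1.
Qed.

(** A normalized f is an orthonormal family with one element, to which [HS_orthonormal_le] applies.
    If f has norm 0, boundedness gives T f norm 0. *)
Lemma opnorm_le_HSnorm T : bounded_op mu T -> (opnorm mu T <= HSnorm mu T)%E.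
Proof.
move=> bT; have [TL _ _ _] := bT; apply: ub_ereal_sup => _ [f [Lf f1] <-].
rewrite HSnormE// esqrt_nrm2; last exact: TL.
apply: esqrt_le.
have S0 : (0 <= \esum_(e in some_ONB mu) nrm2 mu (T e))%E.
  by apply: esum_ge0 => e _; exact: nrm2_ge0.
have [f0|f0] := eqVneq (l2norm mu f) 0.
  have [M M0 /(_ _ Lf)] := bounded_op_nrm2 bT.
  by rewrite (nrm2E Lf) f0 expr0n/= mule0 => /le_trans; exact.
pose c : C := ((l2norm mu f)%:C)%C.
have c0 : c != 0 by rewrite /c eq_complex/= (negbTE f0).
pose g x := c^-1 * f x; have Lg : L2 mu g by exact: L2Z.
have ng : nrm2 mu g = 1%E.
  rewrite nrm2Z; last exact: (L2_cmeas Lf).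
  rewrite (nrm2E Lf) -EFinM; congr EFin.
  by rewrite -(sqabsR (l2norm mu f)) -sqabsM mulVf// sqabs1.
have og : orthonormal_family mu (fun _ : unit => g).
  split => // -[] []; rewrite eqxx innerff//.
  by move: ng; rewrite (nrm2E Lg) => -[->].
have := HS_orthonormal_le (some_ONB_ONB mu) og bT.
rewrite big_const card_unit/= adde0; apply: le_trans.
have -> : nrm2 mu (T f) = nrm2 mu (fun x => c * T g x).
  have fE : f = (fun x => c * g x) by apply/funext => x; rewrite /g mulVKf.
  apply: nrm2_ae; [exact: (L2_cmeas (TL _ Lf))|exact: (L2_cmeas (L2Z _ (TL _ Lg)))|].
  by rewrite {1}fE; exact: bounded_opZ.
rewrite nrm2Z; last exact: (L2_cmeas (TL _ Lg)).
rewrite (nrm2E (TL _ Lg)) -EFinM lee_fin /c sqabsR.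
by rewrite ler_piMl ?sqr_ge0// expr_le1// l2norm_ge0.
Qed.

End OperatorNorms.

(** * Left-invariant operators *)

Section LeftTranslation.
Context {R : realType} {G : ptopologicalType} (grp : compact_group G).
Context (mu : probability (borel_of G) R).
Hypothesis haar : is_haar grp mu.
Local Notation B := (borel_of G).
Local Notation C := R[i].

Lemma cmeasurable_Ltr x (f : B -> C) : cmeasurable f -> cmeasurable (Ltr grp x f).
Proof.
have mt := borel_measurable_continuous (@cg_ltrans_cont _ grp (cg_inv grp x)).
move=> [f1 f2]; split.
  exact: (measurableT_comp f1 mt).
exact: (measurableT_comp f2 mt).
Qed.

Lemma nrm2_Ltr x (f : B -> C) : cmeasurable f -> nrm2 mu (Ltr grp x f) = nrm2 mu f.
Proof.
move=> mf; apply: (integral_ltrans haar x (emeasurable_sqabs mf)).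
by move=> y; rewrite lee_fin sqabs_ge0.
Qed.

Lemma L2_Ltr x (f : B -> C) : L2 mu f -> L2 mu (Ltr grp x f).
Proof.
move=> /L2P[mf ff]; apply/L2P; split; first exact: cmeasurable_Ltr.
by rewrite nrm2_Ltr.
Qed.

Lemma inner_Ltr x (f g : B -> C) : L2 mu f -> L2 mu g ->
  inner mu (Ltr grp x f) (Ltr grp x g) = inner mu f g.
Proof.
move=> Lf Lg; have [i1 i2] := cintegrable_inner Lf Lg.
rewrite !innerE /cintegral; congr (_ +i* _)%C.
  exact: (Rintegral_ltrans haar x i1).
exact: (Rintegral_ltrans haar x i2).
Qed.

Lemma chi_ltrans x S y : chi (ltrans grp x S) (cg_mul grp x y) = chi S y :> C.
Proof. by rewrite /chi /ltrans /= cg_mulKg. Qed.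

End LeftTranslation.

Section InvariantOperator.
Context {R : realType} {G : ptopologicalType} (grp : compact_group G).
Context (mu : probability (borel_of G) R).
Local Notation B := (borel_of G).
Local Notation C := R[i].
Variables (T : (B -> C) -> (B -> C)) (E : set (B -> C)).
Hypotheses (haar : is_haar grp mu) (bT : bounded_op mu T) (ONB_E : ONB mu E).
Hypothesis Tinv : forall (x : G) f, L2 mu f ->
  aeq mu (T (Ltr grp x f)) (Ltr grp x (T f)).

Let LE e : E e -> L2 mu e. Proof. by case: ONB_E => + _ _; apply. Qed.
Let LT f : L2 mu f -> L2 mu (T f). Proof. by case: bT => + _ _ _; apply. Qed.

(** The [nu] of the overview, written as the Hilbert-Schmidt sum of the operator chi_S T. *)
Definition HSmass (S : set B) : \bar R :=
  (\esum_(e in E) nrm2 mu (fun x => (chi S x * T e x)%R))%E.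

Let c : \bar R := (\esum_(e in E) nrm2 mu (T e))%E.

Let HSmass_ge0 S : (0 <= HSmass S)%E.
Proof. by apply: esum_ge0 => e _; exact: nrm2_ge0. Qed.

Let c_ge0 : (0 <= c)%E.
Proof. by apply: esum_ge0 => e _; exact: nrm2_ge0. Qed.

(* Translating a basis gives an orthonormal family, so the mass is left invariant. *)
Lemma HSmass_ltrans_le x S : measurable S -> (HSmass (ltrans grp x S) <= HSmass S)%E.
Proof.
move=> mS; apply: esum_le_fset => A AE.
have oA := orthonormal_fset ONB_E AE.
pose g (e : A) := Ltr grp (cg_inv grp x) (val e).
have og : orthonormal_family mu g.
  split => [e|e e']; first by apply: L2_Ltr => //; exact: oA.1.
  by rewrite inner_Ltr ?oA.2//; exact: oA.1.
apply: le_trans (HS_orthonormal_le ONB_E og (bounded_op_chiM mS bT)).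
rewrite big_seq_fsetE/=; apply: lee_sum => e _.
have Le := oA.1 e; have LTe := LT Le; have mxS := measurable_ltrans grp x mS.
rewrite -(nrm2_Ltr haar (cg_inv grp x) (L2_cmeas (L2_chiM mxS LTe))).
rewrite le_eqVlt; apply/orP; left; apply/eqP; apply: nrm2_ae.
- exact: (cmeasurable_Ltr _ _ (L2_cmeas (L2_chiM mxS LTe))).
- exact: (L2_cmeas (L2_chiM mS (LT (og.1 e)))).
- have /aeqP h := Tinv (cg_inv grp x) Le.
  apply/aeqP; apply: filterS h => y; rewrite /g => ->.
  by rewrite /Ltr cg_invK chi_ltrans.
Qed.

Lemma HSmass_ge S : measurable S -> (mu S * c <= HSmass S)%E.
Proof.
move=> mS; have fS : mu S \is a fin_num by exact: fin_num_measure.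
rewrite -(fineK fS); apply: le_mul_esum => //; first exact: fine_ge0.
move=> A AE; rewrite fineK//; apply/lee_addgt0Pr => eps eps0.
pose h (y : B) : R := \sum_(e <- A) sqabs (T e y).
have AE' (e : A) : L2 mu (T (val e)) by exact/LT/LE/AE/(fsvalP e).
have hE y : (h y)%:E = (\sum_(e : A) (sqabs (T (val e) y))%:E)%E.
  by rewrite /h big_seq_fsetE sumEFin.
have mh : measurable_fun setT (EFin \o h).
  rewrite (_ : EFin \o h = fun y => (\sum_(e : A) (sqabs (T (val e) y))%:E)%E); last exact/funext.
  by apply: emeasurable_sum => e; apply: emeasurable_sqabs; exact: (L2_cmeas (AE' e)).
have inth (D : set B) : measurable D ->
    (\int[mu]_(y in D) (h y)%:E = \sum_(e <- A) nrm2 mu (fun y => (chi D y * T e y)%R))%E.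
  move=> mD; under eq_integral do rewrite hE.
  rewrite ge0_integral_sum//.
  - by rewrite big_seq_fsetE; apply: eq_bigr => e _; rewrite nrm2_chiM.
  - move=> e; apply: measurable_funTS; apply: emeasurable_sqabs; exact: (L2_cmeas (AE' e)).
  - by move=> e y _; rewrite lee_fin sqabs_ge0.
have h0 y : 0 <= h y by apply: sumr_ge0 => e _; exact: sqabs_ge0.
have inthT : (\int[mu]_y (h y)%:E = \sum_(e <- A) nrm2 mu (T e))%E.
  rewrite inth//; apply: eq_bigr => e _; congr nrm2; apply/funext => y.
  by rewrite /chi asboolT// mul1r.
have ih : mu.-integrable setT (EFin \o h).
  apply/integrableP; split => //.
  under eq_integral do rewrite /= ger0_norm//.
  rewrite inthT big_seq_fsetE/=; apply: lte_sum_pinfty => e _.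
  by rewrite (nrm2E (AE' e)) ltry.
have [x hx] := exists_ltrans_integral_ge haar mS h0 ih eps0.
have mxS := measurable_ltrans grp x mS.
rewrite -inthT; apply: (le_trans hx); apply: leeD2r; rewrite inth//.
(* The point x depends on A and on eps; invariance of the mass removes it from the bound. *)
apply: le_trans (HSmass_ltrans_le x mS).
exact: (esum_fset_le (fun e => nrm2 mu (fun y => (chi (ltrans grp x S) y * T e y)%R)) AE).
Qed.

Lemma HSmassE S : measurable S -> HSmass S = (mu S * c)%E.
Proof.
move=> mS; have mCS := measurableC mS.
have split_c : c = (HSmass S + HSmass (~` S))%E.
  rewrite /HSmass -esumD; last 2 first.
  - by move=> e _; exact: nrm2_ge0.
  - by move=> e _; exact: nrm2_ge0.
  apply: eq_esum => e Ee; have me := emeasurable_sqabs (L2_cmeas (LT (LE Ee))).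
  rewrite !nrm2_chiM// -ge0_integral_setU//; last 3 first.
  - by rewrite setUCr.
  - by move=> x _; rewrite lee_fin sqabs_ge0.
  - by apply/disj_setPS => x [].
  by rewrite setUCr.
have h1 := HSmass_ge mS; have h2 := HSmass_ge mCS.
apply/eqP; rewrite eq_le h1 andbT.
have fS : mu S \is a fin_num by exact: fin_num_measure.
(* For infinite c the bound on the complement cannot be subtracted. If mu(S) = 0 all integrals over
   S vanish, in accordance with 0 times oo being 0; otherwise the right-hand side is infinite. *)
have [cy|cfin] := eqVneq c +oo%E.
  have [S0|S0] := eqVneq (mu S) 0%E.
    rewrite S0 mul0e /HSmass esum1// => e Ee; rewrite nrm2_chiM//.
    apply: null_set_integral => //; apply: measurable_funTS.
    exact: (emeasurable_sqabs (L2_cmeas (LT (LE Ee)))).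
  by rewrite cy gt0_muley ?leey// lt_neqAle eq_sym S0 measure_ge0.
have {cfin} : c \is a fin_num by rewrite ge0_fin_numE// ltey.
rewrite probability_setC// in h2; move: h1 h2 split_c.
rewrite -(fineK fS); case: c c_ge0 => // r _ h1 h2 split_c _.
have : HSmass S \is a fin_num.
  rewrite ge0_fin_numE//; apply: (@le_lt_trans _ _ r%:E); last exact: ltry.
  by rewrite split_c leeDl.
have : HSmass (~` S) \is a fin_num.
  rewrite ge0_fin_numE//; apply: (@le_lt_trans _ _ r%:E); last exact: ltry.
  by rewrite split_c leeDr.
move: h1 h2 split_c; case: (HSmass S) => // a; case: (HSmass (~` S)) => // b.
rewrite -EFinB -!EFinM -EFinD !lee_fin => h1 h2 [rab] _ _.
by move: h1 h2; rewrite rab; nra.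
Qed.

(** * Weights integrated against the invariant mass *)

Import HBNNSimple.

Let mass (w : B -> R) : \bar R :=
  (\esum_(e in E) \int[mu]_x (w x * sqabs (T e x))%:E)%E.

Let mLT e : E e -> measurable_fun setT (fun x => sqabs (T e x)).
Proof. by move=> Ee; apply: measurable_sqabs; exact: (L2_cmeas (LT (LE Ee))). Qed.

(** On the range of [phi] the absolute value changes nothing; it makes the coefficients nonnegative
    for every y, as the lemmas on nonnegative sums require. *)
Let nnsfunE (phi : {nnsfun B >-> R}) x :
  phi x = \sum_(y <- fset_set (range phi)) `|y| * \1_(phi @^-1` [set y]) x.
Proof.
rewrite [LHS]fimfunE fsbig_finite//=; apply: eq_big_seq => y.
rewrite in_fset_set// => /set_mem[z _ <-].
by rewrite ger0_norm.
Qed.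

Let mass_nnsfun (phi : {nnsfun B >-> R}) :
  mass phi = ((\int[mu]_x (phi x)%:E) * c)%E.
Proof.
pose Y := fset_set (range phi); pose S y := phi @^-1` [set y].
have mS y : measurable (S y) by rewrite -[S y]setTI; exact: measurable_funPT.
(* A general density q, used both for q = |T e|^2 and for q = 1. *)
have intphi (q : B -> R) : measurable_fun setT q -> (forall x, 0 <= q x) ->
   (\int[mu]_x (phi x * q x)%:E =
    \sum_(y <- Y) (`|y|)%:E * \int[mu]_(x in S y) (q x)%:E)%E.
  move=> mq q0.
  have mSq y : measurable_fun setT (fun x => (\1_(S y) x * q x)%:E).
    by apply/measurable_EFinP; apply: measurable_funM => //; exact: measurable_indic.
  under eq_integral => x _.
    rewrite nnsfunE mulr_suml -sumEFin.
    under eq_bigr do rewrite -mulrA EFinM.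
    over.
  rewrite ge0_integral_sum//.
  - apply: eq_bigr => y _; rewrite ge0_integralZl_EFin//; last 2 first.
    + by move=> x _; rewrite lee_fin mulr_ge0.
    + exact: mSq.
    congr (_ * _)%E; rewrite [RHS]integral_mkcond; apply: eq_integral => x _.
    by rewrite patchE indicE; case: ifP => _; rewrite ?mul1r ?mul0r.
  - by move=> y; apply: measurable_funeM; exact: mSq.
  - by move=> y x _; rewrite -EFinM lee_fin !mulr_ge0.
have -> : (\int[mu]_x (phi x)%:E = \sum_(y <- Y) (`|y|)%:E * mu (S y))%E.
  have := intphi (cst 1) (measurable_cst _) (fun=> ler01).
  under eq_integral do rewrite mulr1.
  by move=> ->; apply: eq_bigr => y _; rewrite -[mu _]mul1e -integral_cst.
rewrite ge0_sume_distrl; last by move=> y _; rewrite mule_ge0// lee_fin.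
rewrite /mass.
transitivity (\esum_(e in E) \sum_(y <- Y) ((`|y|)%:E * nrm2 mu (fun x => (chi (S y) x * T e x)%R)))%E.
  apply: eq_esum => e Ee; rewrite intphi; [|exact: mLT|by move=> x; exact: sqabs_ge0].
  by apply: eq_bigr => y _; rewrite nrm2_chiM.
rewrite esum_sum; last by move=> e y _ _; rewrite mule_ge0 ?nrm2_ge0// lee_fin.
apply: eq_bigr => y _; rewrite esumZl//; last by move=> e; exact: nrm2_ge0.
by rewrite -/(HSmass (S y)) HSmassE// muleA.
Qed.

Let cvg_nnsfun (w q : B -> R) (mw : measurable_fun setT (EFin \o w)) :
  (forall x, 0 <= w x) -> measurable_fun setT q -> (forall x, 0 <= q x) ->
  (\int[mu]_x (nnsfun_approx measurableT mw n x * q x)%:E)%E @[n --> \oo] -->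
  (\int[mu]_x (w x * q x)%:E)%E.
Proof.
move=> w0 mq q0; pose phi := nnsfun_approx measurableT mw.
have cphi x : (phi n x * q x)%:E @[n --> \oo] --> (w x * q x)%:E.
  rewrite EFinM; under eq_fun do rewrite EFinM.
  apply: cvgeM; last exact: cvg_cst.
    by rewrite mule_def_fin.
  have ew0 y : setT y -> (0 <= (EFin \o w) y)%E by rewrite /= lee_fin.
  exact: (@cvg_nnsfun_approx _ _ _ _ measurableT _ mw ew0 x I).
have -> : (\int[mu]_x (w x * q x)%:E = \int[mu]_x limn (fun n => (phi n x * q x)%:E))%E.
  by apply: eq_integral => x _; apply/esym/cvg_lim => //; exact: cphi.
apply: cvg_monotone_convergence => //.
- by move=> n; apply/measurable_EFinP; apply: measurable_funM.
- by move=> n x _; rewrite lee_fin mulr_ge0.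
- move=> x _ n m nm; rewrite lee_fin ler_wpM2r//.
  by have /lefP := nd_nnsfun_approx measurableT mw nm; exact.
Qed.

(** The monotone limit and the unordered sum are exchanged one inequality at a time. For <=, a
    finite part of E is fixed and its integrals are the limit of quantities at most [mass (phi n)].
    For >=, [mass (phi n)] is at most [mass w], while a fixed finite part k of c lets n tend to
    infinity. *)
Lemma HSmass_weight (w : B -> R) : measurable_fun setT w -> (forall x, 0 <= w x) ->
  (\int[mu]_x (w x)%:E < +oo)%E ->
  (\esum_(e in E) \int[mu]_x (w x * sqabs (T e x))%:E = (\int[mu]_x (w x)%:E) * c)%E.
Proof.
move=> mw w0 wfin; rewrite -/(mass w).
have emw : measurable_fun setT (EFin \o w) by exact/measurable_EFinP.
pose phi := nnsfun_approx measurableT emw.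
have phi_w n x : phi n x <= w x.
  have ew0 y : setT y -> (0 <= (EFin \o w) y)%E by rewrite /= lee_fin.
  have cw := @cvg_nnsfun_approx _ _ _ _ measurableT _ emw ew0 x I.
  rewrite -lee_fin; apply: (cvge_ge _ cw).
  exists n => // m /= nm; rewrite lee_fin.
  by have /lefP := nd_nnsfun_approx measurableT emw nm; exact.
have W0 : (0 <= \int[mu]_x (w x)%:E)%E by apply: integral_ge0 => x _; rewrite lee_fin.
have Wf : (\int[mu]_x (w x)%:E)%E \is a fin_num by rewrite ge0_fin_numE.
have cvgW : (\int[mu]_x (phi n x)%:E)%E @[n --> \oo] --> (\int[mu]_x (w x)%:E)%E.
  have := @cvg_nnsfun w (cst 1) emw w0 (measurable_cst _) (fun=> ler01).
  under eq_integral do rewrite mulr1.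
  by under eq_fun do under eq_integral do rewrite mulr1.
apply/eqP; rewrite eq_le; apply/andP; split.
- apply: esum_le_fset => A AE.
  pose q x := \sum_(e : A) sqabs (T (val e) x).
  have q0 x : 0 <= q x by apply: sumr_ge0 => e _; exact: sqabs_ge0.
  have mA (e : A) : measurable_fun setT (fun x => sqabs (T (val e) x)) by apply: mLT; exact/AE/(fsvalP e).
  have mq : measurable_fun setT q by exact: measurable_sum.
  have sumq (v : B -> R) : measurable_fun setT v -> (forall x, 0 <= v x) ->
      (\sum_(e <- A) \int[mu]_x (v x * sqabs (T e x))%:E = \int[mu]_x (v x * q x)%:E)%E.
    move=> mv v0; rewrite big_seq_fsetE/= -ge0_integral_sum//.
    + by apply: eq_integral => x _; rewrite sumEFin mulr_sumr.
    + by move=> e; apply/measurable_EFinP; apply: measurable_funM => //; exact: mA.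
    + by move=> e x _; rewrite lee_fin mulr_ge0 ?sqabs_ge0.
  rewrite sumq//; apply: (cvge_le _ (@cvg_nnsfun w q emw w0 mq q0)).
  apply: nearW => n; rewrite -sumq//.
  apply: (@le_trans _ _ (mass (phi n))).
    exact: (esum_fset_le (fun e => \int[mu]_x (phi n x * sqabs (T e x))%:E)%E AE).
  rewrite mass_nnsfun; apply: lee_wpmul2r => //.
  apply: ge0_le_integral => //.
  + by move=> x _; rewrite lee_fin.
  + exact/measurable_EFinP.
  + by move=> x _; rewrite lee_fin.
- rewrite -(fineK Wf); apply: le_mul_esum; first exact: fine_ge0.
    apply: esum_ge0 => e _; apply: integral_ge0 => x _.
    by rewrite lee_fin mulr_ge0 ?sqabs_ge0.
  move=> A AE; rewrite fineK//; set k := (\sum_(e <- A) _)%E.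
  (* Finiteness of the partial sum keeps the product defined in the limit; c itself may be
     infinite. *)
  have kf : k \is a fin_num.
    rewrite /k big_seq_fsetE/= sum_fin_num; apply/allP => _ /mapP[e _ ->].
    by apply: L2_fin_num; exact/LT/LE/AE/(fsvalP e).
  have k0 : (0 <= k)%E by apply: sume_ge0 => e _; exact: nrm2_ge0.
  have cvgWk : ((\int[mu]_x (phi n x)%:E) * k)%E @[n --> \oo] --> ((\int[mu]_x (w x)%:E) * k)%E.
    by apply: (cvgeM _ cvgW (cvg_cst k)); rewrite mule_def_fin.
  apply: (cvge_le _ cvgWk).
  apply: nearW => n; apply: (@le_trans _ _ (mass (phi n))).
    rewrite mass_nnsfun; apply: lee_wpmul2l.
      by apply: integral_ge0 => x _; rewrite lee_fin.
    exact: (esum_fset_le (fun e => nrm2 mu (T e)) AE).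
  apply: le_esum => e Ee; apply: ge0_le_integral => //.
  + by move=> x _; rewrite lee_fin mulr_ge0 ?sqabs_ge0.
  + by apply/measurable_EFinP; apply: measurable_funM => //; exact: mLT.
  + by apply/measurable_EFinP; apply: measurable_funM => //; exact: mLT.
  + by move=> x _; rewrite lee_fin ler_wpM2r ?sqabs_ge0.
Qed.

End InvariantOperator.

Theorem theorem1 (R : realType) (G : ptopologicalType) (grp : compact_group G)
  (mu : probability (borel_of G) R)
  (P Rop : (borel_of G -> R[i]) -> (borel_of G -> R[i])) :
  is_haar grp mu ->
  bounded_op mu P -> bounded_op mu Rop ->
  (forall S : set (borel_of G), measurable S ->
     forall g, L2 mu g ->
       aeq mu (P (fun y => chi S y * g y)) (fun y => chi S y * P g y)) ->
  (forall (x : G) f, L2 mu f -> aeq mu (Rop (Ltr grp x f)) (Ltr grp x (Rop f))) ->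
  HSnorm mu (P \o Rop) = ((l2norm mu (P (fun=> 1)))%:E * HSnorm mu Rop)%E /\
  (opnorm mu (P \o Rop) <= (l2norm mu (P (fun=> 1)))%:E * HSnorm mu Rop)%E.
Proof.
move=> haar bP bR Pchi Rinv; have bPR := bounded_op_comp bP bR.
suff HS : HSnorm mu (P \o Rop) = ((l2norm mu (P (fun=> 1)))%:E * HSnorm mu Rop)%E.
  by split => //; rewrite -HS; exact: opnorm_le_HSnorm.
have [PL _ _ _] := bP; have [RL _ _ _] := bR.
set p := P (fun=> 1); have Lp : L2 mu p by apply: PL; exact: L2_cst.
have oE := some_ONB_ONB mu; have [LE _ _] := oE.
rewrite !HSnormE// /l2norm -esqrtM; last 2 first.
- by apply: fine_ge0; exact: nrm2_ge0.
- by apply: esum_ge0 => e _; exact: nrm2_ge0.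
congr esqrt; rewrite fineK; last exact: (L2_fin_num Lp).
(* The weight |p|^2 is integrable since p = P 1 is in L^2, and the squared norm of P R e is the
   integral of |p|^2 |R e|^2 because P is multiplication by p. *)
rewrite -(HSmass_weight haar bR oE Rinv (w := fun x => sqabs (p x))); last 3 first.
- exact: (measurable_sqabs (L2_cmeas Lp)).
- by move=> x; exact: sqabs_ge0.
- by case: Lp.
apply: eq_esum => e Ee; have Le := LE _ Ee; have LRe := RL _ Le.
have -> : nrm2 mu ((P \o Rop) e) = nrm2 mu (fun x => p x * Rop e x).
  apply: nrm2_ae; [exact: (L2_cmeas (PL _ LRe))| |exact: (multiplication_op bP Pchi LRe)].
  exact: (cmeasurableM (L2_cmeas Lp) (L2_cmeas LRe)).
by apply: eq_integral => x _; rewrite sqabsM.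
Qed.
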